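(* Let $p$ and $q$ be odd prime numbers such that $p\mid q-1$. Let $u$ denote a fixed element of order $p$ in $(\mathbf Z/(q^2))^*$. On $\mathbf Z/(q^2)\times(\mathbf Z/(p)\times\mathbf Z/(p))$ define the operation $$\left(a,\begin{pmatrix} b_1 \\ b_2 \end{pmatrix}\right)\cdot\left(a',\begin{pmatrix} b_1' \\ b_2' \end{pmatrix}\right)=\left(a+u^{b_2}a',\begin{pmatrix} b_1+b_1' \\ b_2+b_2' \end{pmatrix}\right),$$ for $a,a'\in\mathbf Z/(q^2)$ and $\begin{pmatrix} b_1 \\ b_2 \end{pmatrix},\begin{pmatrix} b_1' \\ b_2' \end{pmatrix}\in\mathbf Z/(p)\times\mathbf Z/(p)$. There are $6p+4$ skew braces, up to isomorphism, with additive group $(\mathbf Z/(q^2)\times(\mathbf Z/(p)\times\mathbf Z/(p)),\cdot)$, whose multiplicative laws $\left(a,\begin{pmatrix} b_1 \\ b_2 \end{pmatrix}\right)\circ\left(a',\begin{pmatrix} b_1' \\ b_2' \end{pmatrix}\right)$ are given by 1. $\left(a+u^{b_1}a',\begin{pmatrix} b_1+b_1' \\ b_2+b_2' \end{pmatrix}\right)$; 2. $\left(u^{b_2'}a+u^{b_1}a',\begin{pmatrix} b_1+b_1' \\ b_2+b_2' \end{pmatrix}\right)$; 3. $\left(a+u^{\ell b_2}a',\begin{pmatrix} b_1+b_1' \\ b_2+b_2' \end{pmatrix}\right)$, $0\le\ell\le p-1$; 4. $\left(u^{b_2'}a+u^{\ell b_2}a',\begin{pmatrix} b_1+b_1' \\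 b_2+b_2' \end{pmatrix}\right)$, $0\le\ell\le p-1$; 5. $\left(a+u^{k(b_1-b_2(b_2-1)/2)}a',\begin{pmatrix} b_1+b_1'+b_2b_2' \\ b_2+b_2' \end{pmatrix}\right)$, $1\le k\le p-1$; 6. $\left(u^{b_2'}a+u^{k(b_1-b_2(b_2-1)/2)}a',\begin{pmatrix} b_1+b_1'+b_2b_2' \\ b_2+b_2' \end{pmatrix}\right)$, $1\le k\le p-1$; 7. $\left(a+u^{\ell b_2}a',\begin{pmatrix} b_1+b_1'+b_2b_2' \\ b_2+b_2' \end{pmatrix}\right)$, $0\le\ell\le p-1$; 8. $\left(u^{b_2'}a+u^{\ell b_2}a',\begin{pmatrix} b_1+b_1'+b_2b_2' \\ b_2+b_2' \end{pmatrix}\right)$, $0\le\ell\le p-1$; 9. $\left(a+a'+qaa',\begin{pmatrix} b_1+b_1' \\ b_2+b_2' \end{pmatrix}\right)$; 10. $\left(u^{b_2'}a+u^{b_2}a'+qaa',\begin{pmatrix} b_1+b_1' \\ b_2+b_2' \end{pmatrix}\right)$; 11. $\left(a+a'+qaa',\begin{pmatrix} b_1+b_1'+b_2b_2' \\ b_2+b_2' \end{pmatrix}\right)$; 12. $\left(u^{b_2'}a+u^{b_2}a'+qaa',\begin{pmatrix} b_1+b_1'+b_2b_2' \\ b_2+b_2' \end{pmatrix}\right)$.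
   Context: A skew (left) brace is a set $B$ with two operations $\cdot,\circ$ such that $(B,\cdot)$ (additive group) and $(B,\circ)$ (multiplicative group) are groups and $x\circ(y\cdot z)=(x\circ y)\cdot x^{-1}\cdot(x\circ z)$ for all $x,y,z\in B$, where $x^{-1}$ is the inverse in $(B,\cdot)$. Two skew braces are isomorphic if there is a bijection between them preserving both operations. The listed laws form a complete and irredundant list of representatives of the isomorphism classes of skew braces with the given additive group. Exponents of $u$ are residue classes in $\mathbf Z/(p)$, which is meaningful since $u^p=1$; division by $2$ is in $\mathbf Z/(p)$. *)

(* Defs.v *)
From HB Require Import structures.
From mathcomp Require Import all_boot all_order all_algebra all_fingroup.

Set Implicit Arguments.
Unset Strict Implicit.
Unset Printing Implicit Defensive.

Import GRing.Theory.
Local Open Scope ring_scope.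

Definition group_axioms (T : Type) (op : T -> T -> T) (e : T) (inv : T -> T) :
    Prop :=
  [/\ associative op, left_id e op, right_id e op,
      left_inverse e inv op & right_inverse e inv op].

Definition is_skew_brace (T : Type) (add mul : T -> T -> T) : Prop :=
  exists (zero : T) (opp : T -> T) (one : T) (inv : T -> T),
    [/\ group_axioms add zero opp,
        group_axioms mul one inv &
        forall x y z : T,
          mul x (add y z) = add (add (mul x y) (opp x)) (mul x z)].

Definition group_isomorphic (S T : Type) (opS : S -> S -> S)
    (opT : T -> T -> T) : Prop :=
  exists2 f : S -> T, bijective f & {morph f : x y / opS x y >-> opT x y}.

Definition skew_brace_isomorphic (S T : Type) (addS mulS : S -> S -> S)
    (addT mulT : T -> T -> T) : Prop :=
  exists f : S -> T,
    [/\ bijective f,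
        {morph f : x y / addS x y >-> addT x y} &
        {morph f : x y / mulS x y >-> mulT x y}].

Notation carrier p q := ('Z_(q ^ 2) * ('F_p * 'F_p))%type.

(* u ^ b for a residue class b mod p, computed on the representative of b in
   {0, ..., p - 1}; independent of the representative when #[u] = p. *)
Definition upow (p q : nat) (u : {unit 'Z_(q ^ 2)}) (b : 'F_p) : 'Z_(q ^ 2) :=
  val (u ^+ (b : nat))%g.

Definition add_law (p q : nat) (u : {unit 'Z_(q ^ 2)}) :
    carrier p q -> carrier p q -> carrier p q :=
  fun '(a, (b1, b2)) '(a', (b1', b2')) =>
    (a + upow u b2 * a', (b1 + b1', b2 + b2')).

Definition mul_laws (p q : nat) (u : {unit 'Z_(q ^ 2)}) :
    seq (carrier p q -> carrier p q -> carrier p q) :=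
     [:: fun '(a, (b1, b2)) '(a', (b1', b2')) =>
           (a + upow u b1 * a', (b1 + b1', b2 + b2'))]
  ++ [:: fun '(a, (b1, b2)) '(a', (b1', b2')) =>
           (upow u b2' * a + upow u b1 * a', (b1 + b1', b2 + b2'))]
  ++ [seq fun '(a, (b1, b2)) '(a', (b1', b2')) =>
           (a + upow u (l%:R * b2) * a', (b1 + b1', b2 + b2'))
       | l <- index_iota 0 p]
  ++ [seq fun '(a, (b1, b2)) '(a', (b1', b2')) =>
           (upow u b2' * a + upow u (l%:R * b2) * a', (b1 + b1', b2 + b2'))
       | l <- index_iota 0 p]
  ++ [seq fun '(a, (b1, b2)) '(a', (b1', b2')) =>
           (a + upow u (k%:R * (b1 - b2 * (b2 - 1) / 2%:R)) * a',
            (b1 + b1' + b2 * b2', b2 + b2'))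
       | k <- index_iota 1 p]
  ++ [seq fun '(a, (b1, b2)) '(a', (b1', b2')) =>
           (upow u b2' * a
              + upow u (k%:R * (b1 - b2 * (b2 - 1) / 2%:R)) * a',
            (b1 + b1' + b2 * b2', b2 + b2'))
       | k <- index_iota 1 p]
  ++ [seq fun '(a, (b1, b2)) '(a', (b1', b2')) =>
           (a + upow u (l%:R * b2) * a', (b1 + b1' + b2 * b2', b2 + b2'))
       | l <- index_iota 0 p]
  ++ [seq fun '(a, (b1, b2)) '(a', (b1', b2')) =>
           (upow u b2' * a + upow u (l%:R * b2) * a',
            (b1 + b1' + b2 * b2', b2 + b2'))
       | l <- index_iota 0 p]
  ++ [:: fun '(a, (b1, b2)) '(a', (b1', b2')) =>
           (a + a' + q%:R * a * a', (b1 + b1', b2 + b2'))]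
  ++ [:: fun '(a, (b1, b2)) '(a', (b1', b2')) =>
           (upow u b2' * a + upow u b2 * a' + q%:R * a * a',
            (b1 + b1', b2 + b2'))]
  ++ [:: fun '(a, (b1, b2)) '(a', (b1', b2')) =>
           (a + a' + q%:R * a * a', (b1 + b1' + b2 * b2', b2 + b2'))]
  ++ [:: fun '(a, (b1, b2)) '(a', (b1', b2')) =>
           (upow u b2' * a + upow u b2 * a' + q%:R * a * a',
            (b1 + b1' + b2 * b2', b2 + b2'))].

(* The default add_law is never reached for i < size (mul_laws p u). *)
Definition mul_law (p q : nat) (u : {unit 'Z_(q ^ 2)}) (i : nat) :
    carrier p q -> carrier p q -> carrier p q :=
  nth (@add_law p q u) (mul_laws p u) i.

Arguments add_law p {q} u _ _.
Arguments mul_law p {q} u i _ _.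

(* Main.v *)
Require Import Defs.
From mathcomp Require Import all_boot all_order all_algebra all_fingroup.
From mathcomp Require Import cyclic finfield ring.
From Stdlib Require Import FunctionalExtensionality.

Set Implicit Arguments.
Unset Strict Implicit.
Unset Printing Implicit Defensive.

Import GRing.Theory.
Local Open Scope ring_scope.

(** Let [x] have last coordinate [b2] and put [w = u^b2].  An automorphism of the
    additive group [A] has the form
      [(a, b) |-> (s a + c (u^b2 - 1), (al b1 + be b2, b2))],
    so that a skew brace on [A] is given by functions [s], [c], [al], [be] of
    [x].  Associativity makes [s] and [al] characters, and [c], [be] cocycles,
    of the multiplicative group.  Counting orders, [al = 1] and [be = d b2].  On
    the subgroup [Q] of order [q^2] the restriction of [c] is [K a] for some
    [K] with [K (K - 1)] divisible by [q].  If [q] divides [K], then [c] is a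
    coboundary [m (1 - s)]; if [q] divides [K - 1], then [a - w c] is a
    coboundary [m (1 - w s)].  In both cases the translation of [a] by a
    multiple of [w - 1] brings the law to
      [(u^(eps b2') a + r(x) a', (b1 + b1' + d b2 b2', b2 + b2'))],
    with [eps] in [{0, 1}] and [r = w s] a character.  Then
    [r(a, b) = u^g(b) + q t a], where [g] is additive for the law on [b], and
    [g(b) = eps b2] unless [q t = 0].  Rescaling by the remaining automorphisms
    of [A] leaves exactly the listed parameters. *)

(** Left translations form a permutation group of order [#|T|], so Lagrange's theorem applies to
    each of them. *)
Lemma iter_op_card (T : finType) (op : T -> T -> T) (e : T) (inv : T -> T) :
  group_axioms op e inv -> forall x, iter #|T| (op x) e = e.
Proof.
move=> [opA op1x opx1 opVx opxV] x.
have inj y : injective (op y).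
  by move=> a b ab; rewrite -[a]op1x -[b]op1x -(opVx y) -!opA ab.
pose L y := perm (inj y).
have LM y z : (L y * L z)%g = L (op z y).
  by apply/permP=> a; rewrite permM !permE opA.
have gL : group_set [set L y | y : T].
  apply/group_setP; split.
    by apply/imsetP; exists e => //; apply/permP=> a; rewrite perm1 permE op1x.
  move=> _ _ /imsetP[y _ ->] /imsetP[z _ ->].
  by rewrite LM; apply/imsetP; exists (op z y).
have cardL : #|[set L y | y : T]| = #|T|.
  rewrite card_imset // => y z /permP /(_ e); rewrite !permE !opx1; exact.
have := order_dvdG (G := Group gL) (imset_f L (isT : x \in T)).
rewrite /= cardL order_dvdn => /eqP /permP /(_ e).
by rewrite perm1 permX => {2}<-; apply: eq_iter => y; rewrite permE.
Qed.

(** * Arithmetic of Z/q^2 and its reduction modulo [q] *)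

Section Ring.

Variables (q : nat) (q_pr : prime q).
Notation R := 'Z_(q ^ 2).
Notation pi := (q%:R : R).

Lemma sqr_prime_gt1 : (1 < q ^ 2)%N.
Proof. by rewrite (ltn_trans (prime_gt1 q_pr)) // -{1}(expn1 q) ltn_exp2l ?prime_gt1. Qed.

(** The reduction morphism onto the residue field; its kernel is generated by [pi], and the units
    are the elements outside it. *)
Definition red (x : R) : 'F_q := (x : nat)%:R.

Lemma natr_eq_mod n m : (n = m %[mod q ^ 2])%N -> n%:R = m%:R :> 'F_q.
Proof.
move=> nm; rewrite -(Fp_nat_mod q_pr n) -(Fp_nat_mod q_pr m).
have qq : (q %| q ^ 2)%N by rewrite dvdn_exp.
by rewrite -(modn_dvdm n qq) nm modn_dvdm.
Qed.

Lemma red_nat n : red n%:R = n%:R.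
Proof.
by apply: natr_eq_mod; rewrite val_Zp_nat ?sqr_prime_gt1 // modn_mod.
Qed.

Lemma natr_valR (x : R) : x = (x : nat)%:R.
Proof. by rewrite natr_Zp. Qed.

Lemma redD : {morph red : x y / x + y}.
Proof.
by move=> x y; rewrite (natr_valR x) (natr_valR y) -natrD !red_nat natrD.
Qed.

Lemma redM : {morph red : x y / x * y}.
Proof.
by move=> x y; rewrite (natr_valR x) (natr_valR y) -natrM !red_nat natrM.
Qed.

Lemma red0 : red 0 = 0. Proof. exact: red_nat 0. Qed.
Lemma red1 : red 1 = 1. Proof. exact: red_nat 1. Qed.

Lemma redN : {morph red : x / - x}.
Proof. by move=> x; apply/eqP; rewrite -addr_eq0 -redD addNr red0. Qed.

Lemma redB : {morph red : x y / x - y}.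
Proof. by move=> x y; rewrite redD redN. Qed.

Lemma redX n : {morph red : x / x ^+ n}.
Proof. by move=> x; elim: n => [|n IH]; rewrite ?red1 // !exprS redM IH. Qed.

Lemma red_pi : red pi = 0.
Proof. by rewrite red_nat pchar_Fp_0. Qed.

Lemma pi_sqr : pi * pi = 0.
Proof. by rewrite -natrM mulnn pchar_Zp ?sqr_prime_gt1. Qed.

Lemma natr_eq0R n : (n%:R == 0 :> R) = (q ^ 2 %| n)%N.
Proof.
rewrite -val_eqE /= val_Zp_nat ?sqr_prime_gt1 //.
Qed.

Lemma natr_eq0F n : (n%:R == 0 :> 'F_q) = (q %| n)%N.
Proof. by rewrite -(dvdn_pcharf (pchar_Fp q_pr)). Qed.

Lemma pi_neq0 : pi != 0.
Proof. by rewrite natr_eq0R gtnNdvd ?prime_gt0 // -{1}(expn1 q) ltn_exp2l ?prime_gt1. Qed.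

Lemma red_eq0 (x : R) : red x = 0 -> exists y, x = pi * y.
Proof.
rewrite /red => /eqP; rewrite natr_eq0F => /dvdnP[y xy].
by exists y%:R; rewrite (natr_valR x) xy natrM mulrC.
Qed.

Lemma pi_mul_eq0 (x : R) : pi * x = 0 -> red x = 0.
Proof.
rewrite (natr_valR x) -natrM => /eqP; rewrite natr_eq0R red_nat => qx.
by apply/eqP; rewrite natr_eq0F -(dvdn_pmul2l (prime_gt0 q_pr)) mulnn.
Qed.

Lemma red_unit (x : R) : (x \is a GRing.unit) = (red x != 0).
Proof.
rewrite {1}(natr_valR x) unitZpE ?sqr_prime_gt1 // natr_eq0F.
by rewrite -prime_coprime // coprime_pexpl.
Qed.

Lemma pow_1pi (z : R) n : (1 + pi * z) ^+ n = 1 + pi * (n%:R * z).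
Proof.
elim: n => [|n IH]; first by rewrite mul0r mulr0 addr0.
rewrite exprS IH -natr1.
have: pi * pi = 0 by exact: pi_sqr.
(* The expansion leaves a term in [k * k]; the same multiple of [k * k = 0] is added to the
   right-hand side. *)
by move: pi => k kk; rewrite -[RHS]addr0 -[X in _ = _ + X](mul0r (z * (n%:R * z))) -kk; ring.
Qed.

(** An element that reduces to 1 is some [1 + pi z], and [(1 + pi z)^n = 1 + n pi z] equals 1 only
    if [q] divides [n z]. *)
Lemma red1_coprime (y : R) n : coprime q n -> red y = 1 -> y ^+ n = 1 -> y = 1.
Proof.
move=> cqn y1; have [|z /eqP] := @red_eq0 (y - 1).
  by rewrite redB y1 red1 subrr.
rewrite subr_eq addrC => /eqP->; rewrite pow_1pi => /eqP.
rewrite -subr_eq0 addrAC subrr add0r => /eqP/pi_mul_eq0/eqP.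
rewrite redM red_nat mulf_eq0 natr_eq0F -[(q %| n)%N]negbK -prime_coprime // cqn /=.
by case/eqP/red_eq0 => t ->; rewrite mulrA pi_sqr mul0r addr0.
Qed.

(** The [q]-th power map is the identity on [F_q]. *)
Lemma red_pow1 (x : R) : x ^+ (q ^ 2) = 1 -> red x = 1.
Proof.
have Fq y : y ^+ q = y :> 'F_q by rewrite -{2}(expf_card y) card_Fp.
by move/(congr1 red); rewrite redX red1 expnS expn1 exprM !Fq.
Qed.

Lemma additiveZ (h : R -> R) : {morph h : x y / x + y} -> forall a, h a = a * h 1.
Proof.
move=> hD; have h0 : h 0 = 0 by apply: (addrI (h 0)); rewrite -hD !addr0.
have hn n : h n%:R = n%:R * h 1.
  by elim: n => [|n IH]; rewrite ?mul0r // -!natr1 hD IH mulrDl mul1r.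
by move=> a; rewrite (natr_valR a) hn.
Qed.

End Ring.

(** * Powers of [u] with exponents in [F_p], and the [p]-th roots of unity *)

Section Powers.

Variables (p q : nat) (u : {unit 'Z_(q ^ 2)}).
Hypotheses (p_pr : prime p) (q_pr : prime q) (pq : (p %| q - 1)%N).
Hypothesis (ordu : #[u]%g = p).
Notation R := 'Z_(q ^ 2).
Notation F := 'F_p.
Notation W := (@upow p q u).

Lemma coprime_qp : coprime q p.
Proof.
rewrite prime_coprime //; apply/negP => qp.
have q1 : (0 < q - 1)%N by rewrite subn_gt0 prime_gt1.
have := leq_trans (dvdn_leq (prime_gt0 p_pr) qp) (dvdn_leq q1 pq).
by rewrite leqNgt ltn_subrL /= (prime_gt0 q_pr).
Qed.

Lemma natr_pZ : (p%:R : R) \is a GRing.unit.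
Proof. by rewrite unitZpE ?sqr_prime_gt1 // coprime_pexpl ?coprime_qp. Qed.

Lemma upow_nat n : W n%:R = (val u) ^+ n.
Proof.
rewrite /upow val_Fp_nat // -FinRing.val_unitX; congr val.
by rewrite -(expg_mod_order u n) ordu.
Qed.

Lemma natr_valF (b : F) : b = (b : nat)%:R.
Proof. by rewrite natr_Zp. Qed.

Lemma upowD b b' : W (b + b') = W b * W b'.
Proof.
by rewrite (natr_valF b) (natr_valF b') -natrD !upow_nat exprD.
Qed.

Lemma upow0 : W 0 = 1. Proof. by rewrite (upow_nat 0) expr0. Qed.

Lemma upowVr b : W b * W (- b) = 1.
Proof. by rewrite -upowD subrr upow0. Qed.

Lemma upow_unit b : W b \is a GRing.unit.
Proof. by apply/unitrPr; exists (W (- b)); rewrite upowVr. Qed.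

Lemma upowXp b : W b ^+ p = 1.
Proof.
by rewrite (natr_valF b) upow_nat exprAC -upow_nat pchar_Fp_0 // upow0 expr1n.
Qed.

(** The order of the reduction divides [p]; if it were 1, then [red1_coprime] would give [u = 1].
    Hence distinct powers of [u] differ by units. *)
Lemma red_primitive : p.-primitive_root (red (val u)).
Proof.
have up : val u ^+ p = 1 by rewrite -upow_nat pchar_Fp_0 // upow0.
have rp : p.-unity_root (red (val u)).
  by rewrite unity_rootE -redX // up red1.
have [m mpr mp] := prim_order_exists (prime_gt0 p_pr) (unity_rootP rp).
case/primeP: (p_pr) => _ /(_ m mp) /orP[/eqP m1|/eqP <- //].
have := prim_expr_order mpr; rewrite m1 expr1 => r1.
have u1 : val u = 1 by apply: (red1_coprime q_pr coprime_qp r1 up).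
have : u = 1%g by apply: val_inj.
move/(congr1 (@order _)); rewrite ordu order1 => p1.
by move: p_pr; rewrite p1.
Qed.

Lemma red_upow_inj b b' : red (W b) = red (W b') -> b = b'.
Proof.
rewrite (natr_valF b) (natr_valF b') !upow_nat !redX // => /eqP.
rewrite (eq_prim_root_expr red_primitive) => /eqP e.
by rewrite -(Fp_nat_mod p_pr) e Fp_nat_mod.
Qed.

Lemma upow_inj : injective W.
Proof. by move=> b b' e; apply: red_upow_inj; rewrite e. Qed.

Lemma upow_sub1_unit b : b != 0 -> W b - 1 \is a GRing.unit.
Proof.
move=> b0; rewrite red_unit // redB // subr_eq0.
by apply: contraNneq b0 => e; apply/eqP/red_upow_inj; rewrite upow0.
Qed.

(** Powers of [red (val u)] exhaust the [p]-th roots of unity in [F_q], and by [red1_coprime] a root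
    is determined by its reduction. *)
Lemma root_upow (x : R) : x ^+ p = 1 -> exists b, x = W b.
Proof.
move=> xp; have rp : red x ^+ p = 1 by rewrite -redX // xp red1.
have [i xi] := prim_rootP red_primitive rp; exists i%:R.
have yp : (x * W (- i%:R)) ^+ p = 1 by rewrite exprMn xp upowXp mulr1.
have := red1_coprime q_pr coprime_qp _ yp; rewrite redM // xi -redX //.
rewrite -upow_nat -redM // upowVr red1 // => /(_ erefl) e.
by rewrite -[x]mulr1 -(upowVr (- i%:R)) mulrA e mul1r opprK.
Qed.

Lemma additiveZF (h : F -> F) :
  {morph h : x y / x + y} -> forall a, h a = h 1 * a.
Proof.
move=> hD; have h0 : h 0 = 0 by apply: (addrI (h 0)); rewrite -hD !addr0.
have hn n : h n%:R = h 1 * n%:R.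
  by elim: n => [|n IH]; rewrite ?mulr0 // -!natr1 hD IH mulrDr mulr1.
by move=> a; rewrite (natr_valF a) hn.
Qed.

End Powers.

Lemma right_group_axioms (T : Type) (op : T -> T -> T) (e : T) (inv : T -> T) :
  associative op -> left_id e op -> right_id e op -> right_inverse e inv op ->
  group_axioms op e inv.
Proof.
move=> opA op1x opx1 opxV; split=> // x.
have e1 : op (op (inv x) x) (op (inv x) (inv (inv x))) = e.
  by rewrite -opA (opA x) opxV op1x opxV.
by move: e1; rewrite opxV opx1.
Qed.

(** * One family of laws containing all those listed *)

Section GenericLaw.

Variables (p q : nat) (u : {unit 'Z_(q ^ 2)}).
Hypotheses (p_pr : prime p) (q_pr : prime q) (pq : (p %| q - 1)%N).
Hypotheses (p_odd : odd p) (ordu : #[u]%g = p).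
Notation R := 'Z_(q ^ 2).
Notation F := 'F_p.
Notation W := (@upow p q u).
Notation pi := (q%:R : R).

(** The map [(b1, b2) |-> (b1 - d b2 (b2 - 1) / 2, b2)] turns the law with term [d b2 b2'] into
    plain addition; [gexp] is the general linear form in these new coordinates. *)
Definition gexp (k l d : F) (b : F * F) : F :=
  k * (b.1 - d * (b.2 * (b.2 - 1) / 2%:R)) + l * b.2.

Definition grho (k l d : F) (t : R) (x : carrier p q) : R :=
  W (gexp k l d x.2) + pi * t * x.1.

Definition glaw (eps : bool) (k l d : F) (t : R) (x y : carrier p q) :
    carrier p q :=
  (W (eps%:R * y.2.2) * x.1 + grho k l d t x * y.1,
   (x.2.1 + y.2.1 + d * (x.2.2 * y.2.2), x.2.2 + y.2.2)).

(** The condition that makes [grho] a character: either its term in [x.1] vanishes, or its value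
    [u^(eps b2)] on the [b]-part matches the twist of [x.1] in the product. *)
Definition gvalid (eps : bool) (k l : F) (t : R) : Prop :=
  pi * t = 0 \/ k = 0 /\ l = eps%:R.

Lemma two_neq0 : (2%:R : F) != 0.
Proof.
rewrite natr_eq0F // gtnNdvd // ltn_neqAle prime_gt1 // andbT.
by apply/eqP=> e; move: p_odd; rewrite -e.
Qed.

Lemma gexpD k l d (b b' : F * F) :
  gexp k l d (b.1 + b'.1 + d * (b.2 * b'.2), b.2 + b'.2) =
  gexp k l d b + gexp k l d b'.
Proof. by rewrite /gexp /=; field; exact: two_neq0. Qed.

Lemma grho_unit k l d t x : grho k l d t x \is a GRing.unit.
Proof.
have := upow_unit p_pr ordu (gexp k l d x.2).
by rewrite !red_unit // redD // !redM // red_pi // !mul0r addr0.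
Qed.

Lemma grhoM eps k l d t x y : gvalid eps k l t ->
  grho k l d t (glaw eps k l d t x y) = grho k l d t x * grho k l d t y.
Proof.
rewrite {1}/grho gexpD upowD //.
case=> [t0 | [-> ->]]; first by rewrite /grho t0 !mul0r !addr0.
rewrite /glaw /grho /gexp /= !mul0r !add0r.
by ring.
Qed.

Lemma upow_eps eps b b' :
  W (eps%:R * (b + b')) = W (eps%:R * b) * W (eps%:R * b').
Proof. by rewrite mulrDr upowD. Qed.

Definition ginv (eps : bool) (k l d : F) (t : R) (x : carrier p q) :
    carrier p q :=
  (- (W (eps%:R * - x.2.2) * x.1) / grho k l d t x,
   (- x.2.1 + d * (x.2.2 * x.2.2), - x.2.2)).

Lemma glaw_group eps k l d t : gvalid eps k l t ->
  group_axioms (glaw eps k l d t) (0, (0, 0)) (ginv eps k l d t).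
Proof.
move=> v; apply: right_group_axioms.
- move=> x y z; rewrite {1 3}/glaw grhoM // /glaw /= upow_eps.
  by congr (_, (_, _)); ring.
- move=> [a [b1 b2]]; rewrite /glaw /grho /gexp /=.
  by congr (_, (_, _)); rewrite ?(mulr0, mul0r, subr0, oppr0, add0r, addr0, upow0, mul1r).
- move=> [a [b1 b2]]; rewrite /glaw /=.
  by congr (_, (_, _)); rewrite ?(mulr0, mul0r, subr0, oppr0, add0r, addr0, upow0, mul1r).
- move=> x; rewrite /glaw /ginv /=; congr (_, (_, _)); last 2 first.
  + by ring.
  + by ring.
  by rewrite [X in _ + X]mulrC divrK ?grho_unit // addrN.
Qed.

Lemma add_law_glaw x y : add_law p u x y = glaw false 0 1 0 0 x y.
Proof.
case: x y => [a [b1 b2]] [a' [b1' b2']]; rewrite /glaw /grho /gexp /=.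
by rewrite !(mul0r, mulr0, subr0, oppr0, add0r, addr0, mul1r, upow0).
Qed.

Lemma group_axioms_ext (T : Type) (op op' : T -> T -> T) e inv :
  (forall x y, op x y = op' x y) -> group_axioms op' e inv -> group_axioms op e inv.
Proof.
move=> E [opA op1x opx1 opVx opxV].
by split=> [x y z|x|x|x|x]; rewrite !E.
Qed.

Lemma add_law_group :
  group_axioms (add_law p u) (0, (0, 0)) (ginv false 0 1 0 0).
Proof.
apply: group_axioms_ext add_law_glaw _; apply: glaw_group; left.
by rewrite mulr0.
Qed.

Lemma glaw_skew_brace eps k l d t : gvalid eps k l t ->
  is_skew_brace (add_law p u) (glaw eps k l d t).
Proof.
move=> v; exists (0, (0, 0)), (ginv false 0 1 0 0), (0, (0, 0)), (ginv eps k l d t).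
split; [exact: add_law_group | exact: glaw_group |].
move=> [a [b1 b2]] [a' [b1' b2']] [a'' [b1'' b2'']].
have wV := upowVr p_pr ordu b2.
have inv0 : ginv false 0 1 0 0 (a, (b1, b2)) = (- (W (- b2) * a), (- b1, - b2)).
  rewrite /ginv; congr (_, (_, _)); last by rewrite /= mul0r addr0.
  have -> : grho 0 1 0 0 (a, (b1, b2)) = W b2.
    by rewrite /grho /gexp /= !(mulr0, mul0r, subr0, oppr0, add0r, addr0, mul1r).
  rewrite /= mul0r upow0 // mul1r; apply: (mulIr (upow_unit p_pr ordu b2)).
  by rewrite divrK ?upow_unit // mulNr mulrAC (mulrC (W (- b2))) wV mul1r.
rewrite inv0 /add_law /glaw /= upow_eps upowD //.
congr (_, (_, _)); try by ring.
move: (grho _ _ _ _ _) => r.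
have -> : b2 + b2' - b2 = b2' by rewrite addrAC subrr add0r.
move: (W b2) (W (- b2)) wV => w w' ww.
case: eps v => v /=; rewrite ?mul1r ?mul0r ?upow0 //; ring: ww.
Qed.

(** The map [(a, b) |-> (S a, (A b1 + B b2, b2))] is an automorphism of the additive group; the new
    parameters come from expressing [gexp] and [t] in the new coordinates. *)
Lemma glaw_iso eps k l d t (A B : F) (S : R) : A != 0 -> S \is a GRing.unit ->
  skew_brace_isomorphic (add_law p u) (glaw eps k l d t)
    (add_law p u) (glaw eps (k / A) (l - k * B / A) (A * d) (t / S)).
Proof.
move=> A0 S1.
exists (fun x : carrier p q => (S * x.1, (A * x.2.1 + B * x.2.2, x.2.2))); split.
- exists (fun x : carrier p q => (S^-1 * x.1, (A^-1 * (x.2.1 - B * x.2.2), x.2.2))).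
    move=> [a [b1 b2]] /=; rewrite mulKr //; congr (_, (_, _)).
    by rewrite addrK mulKf.
  move=> [a [b1 b2]] /=; rewrite mulVKr //; congr (_, (_, _)).
  by rewrite mulVKf // subrK.
- by move=> [a [b1 b2]] [a' [b1' b2']] /=; congr (_, (_, _)); ring.
- move=> [a [b1 b2]] [a' [b1' b2']]; rewrite /glaw /=.
  congr (_, (_, _)); last by ring.
  have -> : grho (k / A) (l - k * B / A) (A * d) (t / S)
      (S * a, (A * b1 + B * b2, b2)) = grho k l d t (a, (b1, b2)).
    rewrite /grho /=; congr (W _ + _).
      by rewrite /gexp /=; field; rewrite two_neq0.
    by rewrite -mulrA [t / S * _]mulrA divrK // mulrA.
  by ring.
Qed.

End GenericLaw.

(** * The listed parameters as normal forms *)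

Definition param := (bool * nat * nat * bool * bool)%type.

(* The arguments [(eps, k, l, d, t)] of [glaw] for the laws of the list, in the
   same order. *)
Definition params (p : nat) : seq param :=
     [:: (false, 1%N, 0%N, false, false)]
  ++ [:: (true, 1%N, 0%N, false, false)]
  ++ [seq (false, 0%N, l, false, false) | l <- index_iota 0 p]
  ++ [seq (true, 0%N, l, false, false) | l <- index_iota 0 p]
  ++ [seq (false, k, 0%N, true, false) | k <- index_iota 1 p]
  ++ [seq (true, k, 0%N, true, false) | k <- index_iota 1 p]
  ++ [seq (false, 0%N, l, true, false) | l <- index_iota 0 p]
  ++ [seq (true, 0%N, l, true, false) | l <- index_iota 0 p]
  ++ [:: (false, 0%N, 0%N, false, true)]
  ++ [:: (true, 0%N, 1%N, false, true)]
  ++ [:: (false, 0%N, 0%N, true, true)]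
  ++ [:: (true, 0%N, 1%N, true, true)].

(** The normal forms under [glaw_iso]: if [k] is nonzero, [B] kills [l]; the scale [A] brings a
    nonzero [d] to 1, or else a nonzero [k] to 1. The clause on [t] restates [gvalid]. *)
Definition canonical (p : nat) (P : param) : bool :=
  let: (eps, k, l, d, t) := P in
  [&& (k < p)%N, (l < p)%N, (k != 0%N) ==> (l == 0%N) && (d || (k == 1%N))
    & t ==> (k == 0%N) && (l == eps)].

Lemma size_params p : (0 < p)%N -> size (params p) = (6 * p + 4)%N.
Proof.
case: p => // p _; rewrite /params !size_cat !size_map !size_iota /= !subSS !subn0.
by rewrite !mulSn mul0n !(addnS, addSn, addn0, addnA).
Qed.

Lemma mem_params p P : (1 < p)%N -> (P \in params p) = canonical p P.
Proof.
move=> p1; have p0 := ltnW p1; apply/idP/idP.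
{ move: P; apply/allP; rewrite /params !all_cat /= !all_map.
  repeat match goal with |- is_true (andb _ _) => apply/andP; split end;
    rewrite ?p1 ?p0 //; by apply/allP => n; rewrite mem_index_iota /= => np;
      rewrite ?np ?p0 ?implybT //; case/andP: np => _ ->. }
case: P => [[[[eps k] l] d] t]; rewrite !mem_cat !inE.
have inj (f : nat -> param) : injective f -> forall n m, (f n \in map f (index_iota m p)) = (m <= n < p)%N.
  by move=> fI n m; rewrite mem_map // mem_index_iota.
case: t => /=; first by
  case/and4P => _ _ _ /andP[/eqP-> /eqP->]; case: eps; case: d; rewrite ?eqxx ?orbT.
case: k => [|k] /=.
  by rewrite andbT => /andP[_ lp]; case: eps; case: d;
    rewrite !(inj (fun l => (_, _, l, _, _))) ?lp ?orbT // => ? ? [].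
rewrite andbT => /and3P[kp _ /andP[/eqP-> dk]]; case: d dk => [_|/eqP[->]].
  by case: eps; rewrite !(inj (fun l => (_, l, _, _, _))) ?kp ?orbT // => ? ? [].
by case: eps; rewrite ?eqxx ?orbT.
Qed.

Lemma uniq_params p : uniq (params p).
Proof.
rewrite /params !cat_uniq !map_inj_uniq ?iota_uniq; try by move=> ? ? [].
have H (s1 s2 : seq param) : (forall x, x \in s1 -> x \in s2 -> False) -> ~~ has (mem s1) s2.
  by move=> s12; apply/hasPn => x x2; apply/negP => x1; apply: (s12 x).
do ![apply/andP; split=> //]; apply: H => x; rewrite ?mem_cat ?inE;
  (first [move/eqP=> ->| case/mapP=> n; rewrite mem_index_iota => n1 ->]);
  do 11?[case/orP]; first
   [ by move=> /eqP[] | by move=> /eqP[] e; subst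
   | by case/mapP=> m; rewrite mem_index_iota => m1 []
   | by case/mapP=> m; rewrite mem_index_iota => m1 [] e; subst].
Qed.

(** * Identification of the listed laws, and reduction of every [glaw] to one of them *)

Section Laws.

Variables (p q : nat) (u : {unit 'Z_(q ^ 2)}).
Hypotheses (p_pr : prime p) (q_pr : prime q) (pq : (p %| q - 1)%N).
Hypotheses (p_odd : odd p) (ordu : #[u]%g = p).
Notation R := 'Z_(q ^ 2).
Notation F := 'F_p.
Notation W := (@upow p q u).
Notation pi := (q%:R : R).

Definition claw (P : param) : carrier p q -> carrier p q -> carrier p q :=
  let: (eps, k, l, d, t) := P in glaw u eps k%:R l%:R d%:R t%:R.

Lemma mul_laws_params : mul_laws p u = map claw (params p).
Proof.
(* The two lists are compared as lists of functions, and the listed laws compute only on explicit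
   tuples. *)
have E (f g : carrier p q -> carrier p q -> carrier p q) :
    (forall a b1 b2 a' b1' b2',
       f (a, (b1, b2)) (a', (b1', b2')) = g (a, (b1, b2)) (a', (b1', b2'))) ->
    f = g.
  move=> fg; apply: functional_extensionality => -[a [b1 b2]].
  by apply: functional_extensionality => -[a' [b1' b2']].
rewrite /mul_laws /params !map_cat -!map_comp.
repeat congr (_ ++ _); rewrite /=; first
 [ congr (_ :: _) | apply: eq_map => n; rewrite /= ]; apply: E => a b1 b2 a' b1' b2';
 rewrite /glaw /grho /gexp /=;
 rewrite ?(mulr0n, mulr1n, mul0r, mulr0, subr0, oppr0, add0r, addr0, mul1r, mulr1) ?upow0 // ?mul1r //.
all: by rewrite ?mulrDl ?addrA ?mul1r.
Qed.

Lemma mul_lawE i : (i < size (mul_laws p u))%N ->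
  mul_law p u i = claw (nth (false, 0%N, 0%N, false, false) (params p) i).
Proof.
by rewrite /mul_law mul_laws_params size_map => ip; rewrite (nth_map (false, 0%N, 0%N, false, false)).
Qed.

Lemma glaw_eq eps (k l d : F) (t t' : R) : pi * t = pi * t' ->
  glaw u eps k l d t = glaw u eps k l d t'.
Proof. by rewrite /glaw /grho => ->. Qed.

Lemma glaw_canonical eps (k l d : F) (t : R) : gvalid eps k l t ->
  exists2 P, P \in params p &
    skew_brace_isomorphic (add_law p u) (glaw u eps k l d t) (add_law p u) (claw P).
Proof.
move=> v; have p1 := prime_gt1 p_pr.
(* [A] makes [A * d] equal to 1 if [d] is nonzero, and otherwise [k / A] equal to 1; [B] cancels
   [l]; [S] makes [t / S] equal to 1. The defaults serve when there is nothing to normalize. *)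
pose A : F := if d != 0 then d^-1 else if k != 0 then k else 1.
pose B : F := if k != 0 then l * A / k else 0.
pose S : R := if pi * t != 0 then t else 1.
have A0 : A != 0.
  by rewrite /A; case: (altP (d =P 0)) => [_|d0]; rewrite ?invr_neq0 //;
     case: (altP (k =P 0)) => // _; rewrite oner_neq0.
have S1 : S \is a GRing.unit.
  rewrite /S; case: (altP (pi * t =P 0)) => [_|t0]; rewrite ?unitr1 //=.
  by rewrite red_unit //; apply: contraNneq t0 => /(red_eq0 q_pr)[y ->];
     rewrite mulrA pi_sqr // mul0r.
exists (eps, nat_of_ord (k / A), nat_of_ord (l - k * B / A), d != 0, pi * t != 0).
  rewrite mem_params // /canonical.
  have lp (x : F) : (x < p)%N by rewrite -{2}(Fp_cast p_pr) ltn_ord.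
  have v0 (x : F) : ((x : nat) == 0%N) = (x == 0) by rewrite -val_eqE.
  have v1 (x : F) : ((x : nat) == 1%N) = (x == 1).
    by rewrite -val_eqE /=.
  have vb (x : F) : ((x : nat) == eps) = (x == eps%:R).
    have e : ((eps%:R : F) : nat) = eps.
      by rewrite val_Fp_nat // modn_small //; case: (eps) => //; exact: prime_gt0.
    by rewrite -[in LHS]e.
  rewrite !lp v0 v1 vb v0 mulf_eq0 invr_eq0 (negbTE A0) orbF /B /A /=.
  apply/andP; split.
    case: (altP (k =P 0)) => //= k0.
    case: (altP (d =P 0)) => /= d0; last first.
      by rewrite andbT subr_eq0; apply/eqP; field; rewrite k0 d0.
    rewrite divff // eqxx andbT subr_eq0; apply/eqP; field; exact: k0.
  case: (altP (pi * t =P 0)) v => //= t0 [/eqP|[-> ->]]; first by rewrite (negbTE t0).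
  by rewrite eqxx /= mulr0 !mul0r subr0.
suff -> : claw (eps, nat_of_ord (k / A), nat_of_ord (l - k * B / A), d != 0, pi * t != 0)
    = glaw u eps (k / A) (l - k * B / A) (A * d) (t / S) by exact: glaw_iso.
rewrite /claw !natr_Zp; have -> : A * d = (d != 0)%:R.
  rewrite /A; case: (altP (d =P 0)) => [->|d0]; first by rewrite mulr0.
  by rewrite mulVf.
apply: glaw_eq; rewrite /S; case: (altP (pi * t =P 0)) => [t0|t0] /=.
  by rewrite mulr0 divr1 t0.
by move: S1; rewrite /S t0 => S1; rewrite divrr.
Qed.

Lemma skew_brace_isomorphic_comp (T1 T2 T3 : Type) (add1 mul1 : T1 -> T1 -> T1)
    (add2 mul2 : T2 -> T2 -> T2) (add3 mul3 : T3 -> T3 -> T3) :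
  skew_brace_isomorphic add1 mul1 add2 mul2 ->
  skew_brace_isomorphic add2 mul2 add3 mul3 ->
  skew_brace_isomorphic add1 mul1 add3 mul3.
Proof.
move=> [f [f_bij fD fM]] [g [g_bij gD gM]]; exists (g \o f); split.
- exact: bij_comp.
- by move=> x y; rewrite /= fD gD.
- by move=> x y; rewrite /= fM gM.
Qed.

End Laws.

(** * Automorphisms of the additive group *)

Section Automorphisms.

Variables (p q : nat) (u : {unit 'Z_(q ^ 2)}).
Hypotheses (p_pr : prime p) (q_pr : prime q) (pq : (p %| q - 1)%N).
Hypotheses (p_odd : odd p) (ordu : #[u]%g = p).
Notation R := 'Z_(q ^ 2).
Notation F := 'F_p.
Notation W := (@upow p q u).
Notation pi := (q%:R : R).

Lemma natr_qF : (q%:R : F) != 0.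
Proof.
rewrite natr_eq0F //; have := coprime_qp p_pr q_pr pq.
by rewrite coprime_sym prime_coprime.
Qed.

(** The value at 1 is killed by [q ^ 2], which is invertible in [F_p]. *)
Lemma additiveRF (h : R -> F) : {morph h : x y / x + y} -> forall a, h a = 0.
Proof.
move=> hD; have h0 : h 0 = 0 by apply: (addrI (h 0)); rewrite -hD !addr0.
have hn n : h n%:R = n%:R * h 1.
  by elim: n => [|n IH]; rewrite ?mul0r // -!natr1 hD IH mulrDl mul1r.
have := hn (q ^ 2)%N; rewrite pchar_Zp ?sqr_prime_gt1 // h0 => /esym /eqP.
rewrite mulf_eq0 natrX expf_eq0 /= (negbTE natr_qF) /= => /eqP h1 a.
by rewrite (natr_valR a) hn h1 mulr0.
Qed.

Definition aut_s (f : carrier p q -> carrier p q) : R := (f (1, (0, 0))).1.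
(** The division by the unit [W 1 - 1] exhibits the first coordinate of [f (0, b)], a cocycle in
    [b], as a coboundary. *)
Definition aut_c (f : carrier p q -> carrier p q) : R :=
  (f (0, (0, 1))).1 / (W 1 - 1).
Definition aut_A (f : carrier p q -> carrier p q) : F := (f (0, (1, 0))).2.1.
Definition aut_B (f : carrier p q -> carrier p q) : F := (f (0, (0, 1))).2.1.

Lemma add_law_pairE (a a' : R) (b b' : F * F) :
  add_law p u (a, b) (a', b') = (a + W b.2 * a', (b.1 + b'.1, b.2 + b'.2)).
Proof. by case: b b' => [b1 b2] [b1' b2']. Qed.

Lemma add_lawE (x y : carrier p q) :
  add_law p u x y = (x.1 + W x.2.2 * y.1, (x.2.1 + y.2.1, x.2.2 + y.2.2)).
Proof. by case: x y => [a [b1 b2]] [a' [b1' b2']]. Qed.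

(* Commuting with the action of [b2] on the normal subgroup [Z/q^2] forces the
   last coordinate to be fixed. *)
Lemma add_law_aut (f : carrier p q -> carrier p q) :
    {morph f : x y / add_law p u x y} -> injective f ->
  [/\ aut_s f \is a GRing.unit, aut_A f != 0 &
      forall a b1 b2, f (a, (b1, b2)) =
        (aut_s f * a + aut_c f * (W b2 - 1), (aut_A f * b1 + aut_B f * b2, b2))].
Proof.
move=> fD fI.
have w0 := upow0 p_pr ordu.
have f0 : f (0, (0, 0)) = (0, (0, 0)).
  have := fD (0, (0, 0)) (0, (0, 0)).
  rewrite !add_lawE /= w0 mulr0 !addr0.
  have z (V : zmodType) (x : V) : x = x + x -> x = 0.
    by move=> e; apply: (addrI x); rewrite addr0 -e.
  case: (f _) => a [b1 b2] /= [e1 /z e2 /z e3].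
  by move: e1; rewrite e2 e3 w0 mul1r => /z ->.
have fQ2 a : (f (a, (0, 0))).2 = (0, 0).
  have D x y : f (x + y, (0, 0)) = add_law p u (f (x, (0, 0))) (f (y, (0, 0))).
    by rewrite -fD add_law_pairE /= w0 mul1r !addr0.
  have h1 := @additiveRF (fun a => (f (a, (0, 0))).2.1).
  have h2 := @additiveRF (fun a => (f (a, (0, 0))).2.2).
  rewrite [LHS]surjective_pairing h1 ?h2 // => x y; by rewrite D add_lawE.
have fQ a : f (a, (0, 0)) = (aut_s f * a, (0, 0)).
  rewrite [LHS]surjective_pairing fQ2; congr (_, _).
  rewrite mulrC; apply: (@additiveZ _ (fun a => (f (a, (0, 0))).1)) => x y.
  have -> : (x + y, (0, 0)) = add_law p u (x, (0, 0)) (y, (0, 0)).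
    by rewrite add_law_pairE /= w0 mul1r !addr0.
  by rewrite fD add_lawE fQ2 /= w0 mul1r.
(* A non-unit would annihilate [pi], against injectivity. *)
have s1 : aut_s f \is a GRing.unit.
  rewrite red_unit //; apply: contra (pi_neq0 q_pr) => /eqP /(red_eq0 q_pr)[y sy].
  have : f (pi, (0, 0)) = f (0, (0, 0)).
    by rewrite f0 fQ sy mulrAC pi_sqr // mul0r.
  by case/fI => /eqP.
have PD (b b' : F * F) : f (0, (b.1 + b'.1, b.2 + b'.2)) =
    add_law p u (f (0, b)) (f (0, b')).
  by rewrite -fD add_law_pairE mulr0 addr0.
have f2 b : (f (0, b)).2.2 = b.2.
  have e1 : add_law p u (0, b) (1, (0, 0)) = add_law p u (W b.2, (0, 0)) (0, b).
    by rewrite !add_law_pairE /= w0 !mulr0 mulr1 !addr0 !add0r; case: (b).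
  have := congr1 f e1; rewrite !fD !fQ !add_lawE /= w0 mul1r mulr1 !addr0 !add0r.
  move/(congr1 fst); rewrite [X in X = _]/fst [X in _ = X]/fst => e2.
  apply: (upow_inj p_pr q_pr pq ordu); apply: (mulIr s1).
  by apply: (addrI (f (0, b)).1); rewrite e2 addrC mulrC.
have f1 b1 b2 : (f (0, (b1, b2))).2.1 = aut_A f * b1 + aut_B f * b2.
  have -> : f (0, (b1, b2)) = add_law p u (f (0, (b1, 0))) (f (0, (0, b2))).
    by rewrite -PD /= addr0 add0r.
  rewrite add_lawE /=; congr (_ + _).
    apply: (@additiveZF p (fun b => (f (0, (b, 0))).2.1)) => x y.
    have := PD (x, 0) (y, 0); rewrite /= addr0 => ->.
    by rewrite add_lawE.
  apply: (@additiveZF p (fun b => (f (0, (0, b))).2.1)) => x y.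
  have := PD (0, x) (0, y); rewrite /= addr0 => ->.
  by rewrite add_lawE.
have u1 : W 1 - 1 \is a GRing.unit.
  by apply: (upow_sub1_unit p_pr q_pr pq ordu); rewrite oner_neq0.
(* [(0, (0, 1))] and [(0, b)] commute. With [x] and [y] the first coordinates of their images, the
   two products give [x + W 1 * y = y + W b.2 * x], which determines [y] from [x]. *)
have f3 b : (f (0, b)).1 = aut_c f * (W b.2 - 1).
  have := PD (0, 1) b; have := PD b (0, 1).
  rewrite /= [b.2 + 1]addrC [b.1 + 0]addrC => -> /(congr1 fst).
  rewrite !add_lawE /= !f2 /= => e.
  apply: (mulIr u1); rewrite mulrAC /aut_c divrK //.
  move: e; move: (W 1) (W _) => w w'; move: (f _).1 (f _).1 => x y e.
  apply/eqP; rewrite -subr_eq0; apply/eqP.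
  transitivity ((x + w * y) - (y + w' * x)); first by ring.
  by rewrite e subrr.
split=> //.
  apply/eqP => A0; have : f (0, (1, 0)) = f (0, (0, 0)).
    have := f1 1 0; have := f2 (1, 0); have := f3 (1, 0); rewrite f0 A0 /=.
    rewrite w0 subrr !mulr0 mul0r addr0.
    by case: (f _) => a [b1 b2] /= -> -> ->.
  by case/fI => /eqP; rewrite oner_eq0.
move=> a b1 b2.
have -> : (a, (b1, b2)) = add_law p u (a, (0, 0)) (0, (b1, b2)).
  by rewrite add_law_pairE /= mulr0 addr0 !add0r.
by rewrite fD fQ add_lawE /= f1 f2 f3 /= w0 mul1r !add0r.
Qed.

End Automorphisms.

(** * Pairwise non-isomorphism of the listed laws *)

Section Distinct.

Variables (p q : nat) (u : {unit 'Z_(q ^ 2)}).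
Hypotheses (p_pr : prime p) (q_pr : prime q) (pq : (p %| q - 1)%N).
Hypotheses (p_odd : odd p) (ordu : #[u]%g = p).
Notation R := 'Z_(q ^ 2).
Notation F := 'F_p.
Notation W := (@upow p q u).
Notation pi := (q%:R : R).

Lemma gexp_00 (k l d : F) : gexp k l d (0, 0) = 0.
Proof. by rewrite /gexp /= !(mul0r, mulr0, subr0, oppr0, add0r). Qed.

Lemma glaw_Q_l eps (k l d : F) (t a a' : R) (b : F * F) :
  glaw u eps k l d t (a, (0, 0)) (a', b) =
  (W (eps%:R * b.2) * a + (1 + pi * t * a) * a', b).
Proof.
rewrite /glaw /grho gexp_00 upow0 //= mul0r mulr0 addr0 !add0r.
by case: b.
Qed.

Lemma glaw_Q_r eps (k l d : F) (t a a' : R) (b : F * F) :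
  glaw u eps k l d t (a', b) (a, (0, 0)) =
  (a' + (W (gexp k l d b) + pi * t * a') * a, b).
Proof.
rewrite /glaw /grho /= !mulr0 upow0 // mul1r !addr0.
by case: b.
Qed.

(** The isomorphism has the shape given by [add_law_aut]. Each parameter is read off from one
    product of simple elements. For [eps] and [gexp] the comparison is made modulo [q], where the
    terms in [t'] disappear and those in [c] cancel. *)
Lemma glaw_iso_params eps (k l d : F) (t : R) eps' (k' l' d' : F) (t' : R) :
  skew_brace_isomorphic (add_law p u) (glaw u eps k l d t)
                        (add_law p u) (glaw u eps' k' l' d' t') ->
  exists A B S, [/\ A != 0, S \is a GRing.unit, A * d = d', pi * t = pi * (t' * S)
    & [/\ eps = eps', k = k' * A & l = k' * B + l']].
Proof.
move=> [f [f_bij fD fM]].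
have [S1 A0 fE] := add_law_aut p_pr q_pr pq ordu fD (bij_inj f_bij).
move: (aut_s f) (aut_A f) (aut_B f) (aut_c u f) S1 A0 fE => S A B c S1 A0 fE.
have w0 := upow0 p_pr ordu.
have fQ a : f (a, (0, 0)) = (S * a, (0, 0)).
  by rewrite fE w0 subrr !mulr0 !addr0.
have fP b : f (0, b) = (c * (W b.2 - 1), (A * b.1 + B * b.2, b.2)).
  by case: b => b1 b2; rewrite fE mulr0 add0r.
have rS : red S != 0 by rewrite -red_unit.
have boolI (x y : bool) : (x%:R : F) = y%:R -> x = y.
  by case: x; case: y => //= /eqP; rewrite ?(eq_sym 0) oner_eq0.
exists A, B, S; split=> //.
- have fS x : (f x).2.1 = A * x.2.1 + B * x.2.2 by case: x => a [b1 b2]; rewrite fE.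
  have fS2 x : (f x).2.2 = x.2.2 by case: x => a [b1 b2]; rewrite fE.
  have := fM (0, (0, 1)) (0, (0, 1)) => /(congr1 (fun x => x.2.1)).
  rewrite fS /glaw [X in X = _]/= [X in _ = X]/= !fS !fS2 /= => e.
  apply: (addrI (B * (1 + 1))); transitivity (A * (0 + 0 + d * (1 * 1)) + B * (1 + 1)).
    by ring.
  by rewrite e; ring.
- have := fM (1, (0, 0)) (1, (0, 0)) => /(congr1 fst).
  rewrite glaw_Q_r !fQ glaw_Q_r !gexp_00 w0 => e.
  apply: (mulrI S1); apply: (addrI (S + S)); move: e; rewrite [X in X = _]/fst [X in _ = X]/fst => e.
  transitivity (S * (1 + (1 + pi * t * 1) * 1)); first by ring.
  by rewrite e; ring.
- have eps_eq : eps = eps'.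
    have := fM (1, (0, 0)) (0, (0, 1)) => /(congr1 (fun x => red x.1)).
    rewrite glaw_Q_l fQ !fP glaw_Q_l fE /=.
    rewrite !redD // !redM // !redD // !redM // !red_pi // !mul0r !mulr0 !addr0 red1 // mul1r !mulr1.
    move/addIr; rewrite mulrC => /(mulIf rS) /(red_upow_inj p_pr q_pr pq ordu).
    exact: boolI.
  have G b : gexp k l d b = gexp k' l' d' (A * b.1 + B * b.2, b.2).
      have := fM (0, b) (1, (0, 0)) => /(congr1 (fun x => red x.1)).
      rewrite glaw_Q_r fQ !fP glaw_Q_r; case: b => b1 b2; rewrite fE /=.
      rewrite !redD // !redM // !redD // !redM // !red_pi // !mul0r !mulr0 !addr0 red1 // !mulr1 add0r addrC.
      by move/addrI; rewrite mulrC => /(mulIf rS) /(red_upow_inj p_pr q_pr pq ordu).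
    have kA : k = k' * A.
      by have := G (1, 0); rewrite /gexp /= !(mul0r, mulr0, subr0, oppr0, add0r, addr0, mulr1).
    split=> //; have := G (0, 1).
    by rewrite /gexp /= !(mul0r, mulr0, subrr, subr0, oppr0, add0r, addr0, mulr1).
Qed.

(** If [k = 0], then [k' = 0] and [l] is invariant. Otherwise both [l] and [l'] vanish, and either
    [d] forces [A = 1] or both [k] and [k'] are already 1. *)
Lemma claw_inj P P' : P \in params p -> P' \in params p ->
  skew_brace_isomorphic (add_law p u) (claw u P) (add_law p u) (claw u P') ->
  P = P'.
Proof.
rewrite !mem_params ?prime_gt1 //; case: P P' => [[[[eps k] l] d] t] [[[[eps' k'] l'] d'] t'].
move=> /and4P[kp lp kc tc] /and4P[kp' lp' kc' tc'].
move=> /glaw_iso_params[A [B [S [A0 S1 dA tS [eps_eq kA lB]]]]].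
have p1 := prime_gt1 p_pr.
have FI n m : (n < p)%N -> (m < p)%N -> n%:R = m%:R :> F -> n = m.
  move=> np mp /(congr1 (fun x : F => x : nat)).
  by rewrite !val_Fp_nat // !modn_small.
have F0 n : (n < p)%N -> (n%:R == 0 :> F) = (n == 0%N).
  by move=> np; apply/eqP/eqP => [|-> //]; exact: (FI n 0%N np (ltnW p1)).
have d_eq : d = d'.
  move: dA; case: (d); case: (d') => //= /eqP; rewrite ?mulr1 ?mulr0 ?(negbTE A0) //.
have t_eq : t = t'.
  move: tS; case: (t); case: (t') => //= /eqP; rewrite ?mulr1 ?mulr0 ?mul0r ?mul1r ?mulr0 ?(negbTE (pi_neq0 q_pr)) //.
  by move=> /eqP/esym/(pi_mul_eq0 q_pr)/eqP; move: S1; rewrite red_unit // => /negbTE->.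
move: dA kc kc' tc tc'; rewrite -d_eq -t_eq -eps_eq => {d_eq t_eq eps_eq tS}.
have k0 : (k == 0%N) = (k' == 0%N).
  by rewrite -!F0 // kA mulf_eq0 (negbTE A0) orbF.
move=> dA kc kc' _ _; have [k_eq|k_neq] := boolP (k == 0%N).
  have k'0 : k' = 0%N by apply/eqP; rewrite -k0.
  by move: lB; rewrite k'0 mul0r add0r => /(FI _ _ lp lp') ->; rewrite (eqP k_eq).
move: kc kc'; rewrite -k0 (k_neq) /= => /andP[/eqP-> dk] /andP[/eqP-> dk'].
suff -> : k = k' by [].
case: d dA dk dk' => /= [|_ /eqP-> /eqP-> //].
by rewrite mulr1 => A1 _ _; apply: FI => //; rewrite kA A1 mulr1.
Qed.

Lemma mul_law_distinct i j :
  (i < size (mul_laws p u))%N -> (j < size (mul_laws p u))%N ->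
  skew_brace_isomorphic (add_law p u) (mul_law p u i)
                        (add_law p u) (mul_law p u j) -> i = j.
Proof.
move=> ip jp; rewrite !mul_lawE //.
move: ip jp; rewrite mul_laws_params // size_map => ip jp.
move/claw_inj => /(_ (mem_nth _ ip) (mem_nth _ jp)) /eqP.
by rewrite nth_uniq // ?uniq_params // => /eqP.
Qed.

End Distinct.

(** * Coprime exponents, and skew braces with additive group Z/q^2 *)

Lemma expr1_coprime (V : pzRingType) (x : V) m n :
  (0 < m)%N -> coprime m n -> x ^+ m = 1 -> x ^+ n = 1 -> x = 1.
Proof.
move=> m0 /(coprimeP _ m0)[[i j] /= ij] xm xn.
have e : (i * m = j * n + 1)%N.
  by rewrite -ij addnC subnK // ltnW // -subn_gt0 ij.
have := congr1 (fun k => x ^+ k) e; rewrite exprD expr1.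
by rewrite mulnC exprM xm expr1n mulnC exprM xn expr1n mul1r.
Qed.

(* The multiplicative group induced on [Z/q^2], where
   [a o a' = a + s a * a']. *)
Section CyclicBrace.

Variables (q : nat) (q_pr : prime q).
Notation R := 'Z_(q ^ 2).
Notation pi := (q%:R : R).
Variables (s : R -> R).
Hypothesis sU : forall a, s a \is a GRing.unit.
Hypothesis sM : forall a a', s (a + s a * a') = s a * s a'.

Let op a a' := a + s a * a'.

Lemma cyc_s0 : s 0 = 1.
Proof. by apply: (mulrI (sU 0)); rewrite -sM mulr0 addr0 mulr1. Qed.

Lemma cyc_group : group_axioms op 0 (fun a => - ((s a)^-1 * a)).
Proof.
apply: right_group_axioms.
- by move=> a b c; rewrite /op sM; ring.
- by move=> a; rewrite /op cyc_s0 mul1r add0r.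
- by move=> a; rewrite /op mulr0 addr0.
- by move=> a; rewrite /op mulrN mulVKr // subrr.
Qed.

Lemma cyc_iter a : iter (q ^ 2) (op a) 0 = 0.
Proof.
have := iter_op_card cyc_group a.
by rewrite card_ord Zp_cast // sqr_prime_gt1.
Qed.

(** [s] is a character of a group of order [q ^ 2], so [red_pow1] applies to its values. *)
Lemma cyc_red_s a : red (s a) = 1.
Proof.
have sn n : s (iter n (op a) 0) = s a ^+ n.
  by elim: n => [|n IH]; rewrite ?cyc_s0 // exprS -IH -sM.
by apply: red_pow1 => //; rewrite -sn cyc_iter cyc_s0.
Qed.

(** A group of order [q ^ 2] has no nonzero homomorphism to a field in which [q] is invertible. *)
Lemma cyc_hom_eq0 (V : fieldType) (f : R -> V) :
  (q%:R : V) != 0 -> (forall a a', f (op a a') = f a + f a') -> forall a, f a = 0.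
Proof.
move=> q0 fM a; have f0 : f 0 = 0.
  by apply: (addrI (f 0)); rewrite -fM /op mulr0 !addr0.
have fn n : f (iter n (op a) 0) = n%:R * f a.
  elim: n => [|n IH]; first by rewrite f0 mul0r.
  by rewrite iterS fM IH -natr1 mulrDl mul1r addrC.
have := fn (q ^ 2)%N; rewrite cyc_iter f0 natrX => /esym/eqP; rewrite mulf_eq0 expf_eq0 /= (negbTE q0).
by move/eqP.
Qed.

(** Put [s = 1 + e], with values of [e] divisible by [pi]. Their products vanish, so
    multiplicativity of [s] reads [e (a + b + e a * b) = e a + e b]. Once [e] vanishes on multiples
    of [pi], the correction [e a * b] is invisible and [e] is additive. *)
Lemma cyc_s : exists t, forall a, s a = 1 + pi * t * a.
Proof.
pose e a := s a - 1.
have sE a : s a = 1 + e a by rewrite /e addrC subrK.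
have [g eg] : exists g : R, e pi = pi * g.
  by apply: red_eq0 => //; rewrite redB // cyc_red_s red1 // subrr.
have eM a b : e (a + b + e a * b) = e a + e b.
  have [t ea] : exists t, e a = pi * t.
    by apply: red_eq0 => //; rewrite redB // cyc_red_s red1 // subrr.
  have [t' eb] : exists t, e b = pi * t.
    by apply: red_eq0 => //; rewrite redB // cyc_red_s red1 // subrr.
  have -> : a + b + e a * b = a + s a * b by rewrite sE; ring.
  rewrite {1}/e sM !sE ea eb; have := pi_sqr q_pr.
  move: pi => k kk; ring: kk.
have kk := pi_sqr q_pr.
(* Otherwise [pi o x = x] for [x = - g^-1]. *)
have rg : red g = 0.
  apply/eqP/negPn/negP; rewrite -red_unit // => gU.
  have := eM pi (- g^-1).
  have -> : pi + - g^-1 + e pi * - g^-1 = - g^-1 by rewrite eg mulrN mulrK //; ring.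
  move/(congr1 (fun x => x - e (- g^-1))); rewrite addrK subrr eg => /esym.
  by move/pi_mul_eq0 => /(_ q_pr) /eqP; move: gU; rewrite red_unit // => /negP.
have ep : e pi = 0 by case: (red_eq0 q_pr rg) => y gy; rewrite eg gy mulrA kk mul0r.
have epi x : e (pi * x) = 0.
  rewrite (natr_valR x); elim: (x : nat) => [|n IH].
    by rewrite mulr0 /e cyc_s0 subrr.
  have := eM (pi * n%:R) pi; rewrite IH ep mul0r !addr0 => <-.
  by rewrite -natr1 mulrDr mulr1.
have eD : {morph e : x y / x + y}.
  move=> x y; rewrite -eM.
  have [t et] : exists t, e x = pi * t.
    by apply: red_eq0 => //; rewrite redB // cyc_red_s red1 // subrr.
  have := eM (pi * (t * y)) (x + y); rewrite epi mul0r add0r addr0 => <-.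
  by rewrite et mulrA addrC.
have [t et] : exists t, e 1 = pi * t.
  by apply: red_eq0 => //; rewrite redB // cyc_red_s red1 // subrr.
by exists t => a; rewrite sE (additiveZ eD) et mulrC.
Qed.

(* The element [1] generates the multiplicative group, since its [n]-th power
   is [n + pi * t * 'C(n, 2)], and [q] is odd. *)
Lemma cyc_cocycle (f : R -> R) : odd q ->
  (forall a a', f (op a a') = f a + s a * f a') -> forall a, f a = f 1 * a.
Proof.
move=> q_odd fM; have [t st] := cyc_s; have kk := pi_sqr q_pr.
have f0 : f 0 = 0.
  by have := fM 0 0; rewrite /op cyc_s0 !mul1r addr0 => /eqP; rewrite -subr_eq0 opprD addrA subrr sub0r oppr_eq0 => /eqP.
have opn n : iter n (op 1) 0 = n%:R + pi * t * 'C(n, 2)%:R.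
  elim: n => [|n IH]; first by rewrite bin0n mulr0 addr0.
  rewrite iterS IH /op st mulr1 binS bin1 natrD -natr1.
  by move: pi kk => k kk; ring: kk.
have fn n : f (iter n (op 1) 0) = f 1 * iter n (op 1) 0.
  elim: n => [|n IH]; first by rewrite f0 mulr0.
  by rewrite iterS fM IH /op; ring.
have U2 : (2%:R : R) \is a GRing.unit.
  rewrite unitZpE ?sqr_prime_gt1 // coprime_pexpl // coprime_sym prime_coprime //.
  by rewrite dvdn2 q_odd.
(* [x] inverts [n |-> n + pi t 'C(n, 2)] at [a]: since [x] and [a] agree modulo [pi],
   [pi 'C(x, 2) = pi a (a - 1) / 2]. *)
move=> a; pose x := a - pi * t * (a * (a - 1) / 2%:R).
suff <- : iter x (op 1) 0 = a by exact: fn.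
rewrite opn natr_Zp.
have bx : pi * 'C(x, 2)%:R = pi * (a * (a - 1) / 2%:R).
  have b2 n : 'C(n, 2)%:R * 2%:R = n%:R * (n%:R - 1) :> R.
    elim: n => [|n IH]; first by rewrite bin0n !mul0r.
    by rewrite binS bin1 natrD mulrDl IH -natr1; ring.
  apply: (mulIr U2); rewrite -!mulrA mulVr // mulr1 b2 natr_Zp.
  by rewrite /x; move: pi kk (_ / _) => k kk h; ring: kk.
by rewrite mulrAC bx /x; ring.
Qed.

End CyclicBrace.

(** * Lambda maps of a skew brace and their coordinates *)

Section Lambda.

Variables (p q : nat) (u : {unit 'Z_(q ^ 2)}).
Hypotheses (p_pr : prime p) (q_pr : prime q) (pq : (p %| q - 1)%N).
Hypotheses (p_odd : odd p) (ordu : #[u]%g = p).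
Notation R := 'Z_(q ^ 2).
Notation F := 'F_p.
Notation W := (@upow p q u).

Variables (mul : carrier p q -> carrier p q -> carrier p q).
Variables (one : carrier p q) (inv : carrier p q -> carrier p q).
Hypothesis mulG : group_axioms mul one inv.

(** For each [x] the map [y |-> - x + x o y] is additive by the brace identity and injective by
    cancellation, so [add_law_aut] describes it. *)
Lemma lambda_coordinates zero opp : group_axioms (add_law p u) zero opp ->
  (forall x y z, mul x (add_law p u y z) =
     add_law p u (add_law p u (mul x y) (opp x)) (mul x z)) ->
  exists (s c : carrier p q -> R) (al be : carrier p q -> F),
    [/\ forall x, s x \is a GRing.unit, forall x, al x != 0 &
      forall x y, mul x y =
        (x.1 + W x.2.2 * (s x * y.1 + c x * (W y.2.2 - 1)),
         (x.2.1 + (al x * y.2.1 + be x * y.2.2), x.2.2 + y.2.2))].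
Proof.
move=> [addA add0x addx0 addNx addxN] mulD.
pose lam x y := add_law p u (opp x) (mul x y).
have lamE x y : mul x y = add_law p u x (lam x y) by rewrite /lam addA addxN add0x.
have lamD x : {morph lam x : y z / add_law p u y z}.
  by move=> y z; rewrite /lam mulD !addA.
have lamI x : injective (lam x).
  case: mulG => mA m1 _ mV _ y z /(congr1 (add_law p u x)).
  rewrite -!lamE => /(congr1 (mul (inv x))).
  by rewrite !mA mV !m1.
have L x := add_law_aut p_pr q_pr pq ordu (lamD x) (@lamI x).
exists (fun x => aut_s (lam x)), (fun x => aut_c u (lam x)),
  (fun x => aut_A (lam x)), (fun x => aut_B (lam x)); split=> [x|x|x [a [b1 b2]]].
- by have [] := L x.
- by have [] := L x.
- by have [_ _ E] := L x; rewrite lamE E add_lawE.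
Qed.

Section Coordinates.

Variables (s c : carrier p q -> R) (al be : carrier p q -> F).
Hypotheses (sU : forall x, s x \is a GRing.unit) (al0 : forall x, al x != 0).
Hypothesis mulE : forall x y, mul x y =
  (x.1 + W x.2.2 * (s x * y.1 + c x * (W y.2.2 - 1)),
   (x.2.1 + (al x * y.2.1 + be x * y.2.2), x.2.2 + y.2.2)).

Let w0 : W 0 = 1. Proof. exact: upow0. Qed.

(** Evaluation at [z] equal to [(1, (0, 0))], [(0, (0, 1))] and [(0, (1, 0))] isolates the laws of
    [s], [c], [al] and [be]. *)
Lemma coord_assoc x y z :
  x.1 + W x.2.2 * (s x * (y.1 + W y.2.2 * (s y * z.1 + c y * (W z.2.2 - 1))) +
       c x * (W y.2.2 * W z.2.2 - 1)) =
  x.1 + W x.2.2 * (s x * y.1 + c x * (W y.2.2 - 1)) +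
    W x.2.2 * W y.2.2 * (s (mul x y) * z.1 + c (mul x y) * (W z.2.2 - 1)) /\
  x.2.1 + (al x * (y.2.1 + (al y * z.2.1 + be y * z.2.2)) + be x * (y.2.2 + z.2.2)) =
  x.2.1 + (al x * y.2.1 + be x * y.2.2) +
    (al (mul x y) * z.2.1 + be (mul x y) * z.2.2).
Proof.
case: mulG => /(_ x y z) + _ _ _ _.
have := mulE x y; move: (mul x y) => m e; rewrite (mulE x) mulE (mulE m) e /=.
rewrite !upowD // => E.
by split; [exact: (congr1 fst E) | exact: (congr1 (fun x => x.2.1) E)].
Qed.

Lemma coord_sM x y : s (mul x y) = s x * s y.
Proof.
have [e _] := coord_assoc x y (1, (0, 0)); move: e; rewrite /= w0 !mulr1.
rewrite subrr !(mulr0, addr0) => e.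
apply: (mulrI (upow_unit p_pr ordu x.2.2)); apply: (mulrI (upow_unit p_pr ordu y.2.2)).
apply: (addrI (x.1 + W x.2.2 * (s x * y.1 + c x * (W y.2.2 - 1)))).
rewrite (mulrCA (W y.2.2)) [W x.2.2 * (W y.2.2 * _)]mulrA -e; ring.
Qed.

Lemma coord_cM x y : c (mul x y) = c x + s x * c y.
Proof.
have [e _] := coord_assoc x y (0, (0, 1)); move: e; rewrite /= !mulr0 !add0r => e.
have u1 : W 1 - 1 \is a GRing.unit.
  by apply: (upow_sub1_unit p_pr q_pr pq ordu); rewrite oner_neq0.
apply: (mulrI (upow_unit p_pr ordu x.2.2)); apply: (mulrI (upow_unit p_pr ordu y.2.2)).
apply: (mulIr u1); apply: (addrI (x.1 + W x.2.2 * (s x * y.1 + c x * (W y.2.2 - 1)))).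
transitivity (x.1 + W x.2.2 * (s x * y.1 + c x * (W y.2.2 - 1)) +
   W x.2.2 * W y.2.2 * (c (mul x y) * (W 1 - 1))); first by ring.
by rewrite -e; ring.
Qed.

Lemma coord_alM x y : al (mul x y) = al x * al y.
Proof.
have [_ e] := coord_assoc x y (0, (1, 0)); move: e; rewrite /=.
rewrite !mulr0 !mulr1 !addr0 => e; apply/esym.
apply: (addrI (x.2.1 + (al x * y.2.1 + be x * y.2.2))); rewrite -e; ring.
Qed.

Lemma coord_beM x y : be (mul x y) = be x + al x * be y.
Proof.
have [_ e] := coord_assoc x y (0, (0, 1)); move: e; rewrite /=.
rewrite !mulr0 !mulr1 !add0r => e; apply/esym.
apply: (addrI (x.2.1 + (al x * y.2.1 + be x * y.2.2))); rewrite -e; ring.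
Qed.

(** The group has order [q ^ 2 * p ^ 2], and [p]-th powers are trivial on [F_p], so [al x] has order
    dividing [q ^ 2] as well as [p - 1]; these are coprime since [q > p]. *)
Lemma coord_al x : al x = 1.
Proof.
have al1 : al one = 1.
  case: mulG => _ m1 _ _ _.
  by apply: (mulfI (al0 one)); rewrite -coord_alM m1 mulr1.
have aln n : al (iter n (mul x) one) = al x ^+ n.
  by elim: n => [|n IH] //; rewrite iterS coord_alM IH exprS.
have alF : al x ^+ p = al x by rewrite -{2}(expf_card (al x)) card_Fp.
have alq : al x ^+ (q ^ 2) = 1.
  have := aln #|{: carrier p q}|; rewrite (iter_op_card mulG) al1 => /esym.
  have -> : #|{: carrier p q}| = (q ^ 2 * (p * p))%N.
    by rewrite !card_prod !card_ord Zp_cast ?sqr_prime_gt1 // !Fp_cast.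
  by rewrite mulnC -mulnA !exprM !alF.
have alp : al x ^+ p.-1 = 1.
  by apply: (mulfI (al0 x)); rewrite -exprS prednK ?prime_gt0 // alF mulr1.
apply: (expr1_coprime _ _ alq alp); first by rewrite expn_gt0 prime_gt0.
rewrite coprime_pexpl // prime_coprime //.
have q1 : (0 < q - 1)%N by rewrite subn_gt0 prime_gt1.
have pltq : (p < q)%N.
  by rewrite (leq_ltn_trans (dvdn_leq q1 pq)) // ltn_subrL /= prime_gt0.
have p1 : (0 < p.-1)%N by rewrite -ltnS prednK ?prime_gt1 ?prime_gt0.
by rewrite gtnNdvd // (leq_ltn_trans (leq_pred p)).
Qed.

Lemma coord_Q a a' :
  mul (a, (0, 0)) (a', (0, 0)) = (a + s (a, (0, 0)) * a', (0, 0)).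
Proof. by rewrite mulE /= w0 subrr !(mulr0, addr0) mul1r. Qed.

(** Hence a homomorphism trivial on Z/q^2 depends on [b] alone. *)
Lemma coord_fiber a b : exists a', mul (0, b) (a', (0, 0)) = (a, b).
Proof.
exists ((W b.2)^-1 * ((s (0, b))^-1 * a)).
rewrite mulE /= w0 subrr !(mulr0, addr0) add0r mulrCA mulVKr ?upow_unit // mulVKr //.
by case: b.
Qed.

(** As [al = 1], [be] is a homomorphism to [F_p]; it kills Z/q^2 because [q] is invertible in [F_p].
    It remains to show that it ignores [b1]. *)
Lemma coord_be : exists d, forall x, be x = d * x.2.2.
Proof.
have beM y z : be (mul y z) = be y + be z by rewrite coord_beM coord_al mul1r.
have beQ a : be (a, (0, 0)) = 0.
  pose sQ a := s (a, (0, 0)).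
  have sQU a1 : sQ a1 \is a GRing.unit by exact: sU.
  have sQM a1 a2 : sQ (a1 + sQ a1 * a2) = sQ a1 * sQ a2.
    by rewrite /sQ -coord_Q coord_sM.
  apply: (cyc_hom_eq0 q_pr sQU sQM (f := fun a => be (a, (0, 0)))).
    exact: natr_qF p_pr q_pr pq.
  by move=> a1 a2; rewrite -coord_Q beM.
have beP a b : be (a, b) = be (0, b).
  by have [a' <-] := coord_fiber a b; rewrite beM beQ addr0.
(* Otherwise, with [e] this value, the product of [(0, (1, 0))] and [(0, (0, - e^-1))] lies over the
   same [b] as its second factor, which forces [e = 0]. *)
have e0 : be (0, (1, 0)) = 0.
  apply/eqP/negPn/negP => e0; set e := be _ in e0.
  have := beM (0, (1, 0)) (0, (0, - e^-1)).
  rewrite mulE /= coord_al -/e beP mulrN divff // mul1r !add0r addrN.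
  move/(congr1 (fun x => x - be (0, (0, - e^-1)))); rewrite addrK subrr => /esym/eqP.
  by rewrite (negbTE e0).
have be1 b : be (0, (b, 0)) = 0.
  have D : {morph (fun b => be (0, (b, 0))) : x y / x + y}.
    by move=> b1 b2; rewrite -beM mulE [RHS]beP /= coord_al mulr0 !addr0 mul1r.
  by rewrite (additiveZF D) e0 mul0r.
have be2 a b1 b2 : be (a, (b1, b2)) = be (0, (0, b2)).
  rewrite beP; have := beM (0, (b1, 0)) (0, (0, b2)); rewrite be1 add0r => <-.
  by rewrite mulE /= [RHS]beP coord_al be1 mul0r !mulr0 !addr0 add0r.
exists (be (0, (0, 1))) => -[a [b1 b2]]; rewrite be2 /=.
apply: (additiveZF (h := fun b => be (0, (0, b)))) => b b'.
by rewrite -beM mulE be2.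
Qed.

End Coordinates.

End Lambda.

(** * Cocycles as coboundaries, and normalization of the first coordinate *)

Section Normalization.

Variables (p q : nat) (u : {unit 'Z_(q ^ 2)}).
Hypotheses (p_pr : prime p) (q_pr : prime q) (pq : (p %| q - 1)%N).
Hypotheses (q_odd : odd q) (ordu : #[u]%g = p).
Notation R := 'Z_(q ^ 2).
Notation F := 'F_p.
Notation W := (@upow p q u).
Notation pi := (q%:R : R).

Variables (mul : carrier p q -> carrier p q -> carrier p q).
Variables (s c : carrier p q -> R) (d : F).
Hypothesis sU : forall x, s x \is a GRing.unit.
Hypothesis sM : forall x y, s (mul x y) = s x * s y.
Hypothesis cM : forall x y, c (mul x y) = c x + s x * c y.
Hypothesis mulE : forall x y, mul x y =
  (x.1 + W x.2.2 * (s x * y.1 + c x * (W y.2.2 - 1)),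
   (x.2.1 + y.2.1 + d * (x.2.2 * y.2.2), x.2.2 + y.2.2)).

Let w0 : W 0 = 1. Proof. exact: upow0. Qed.

Lemma norm_Q a a' :
  mul (a, (0, 0)) (a', (0, 0)) = (a + s (a, (0, 0)) * a', (0, 0)).
Proof. by rewrite mulE /= w0 subrr !(mulr0, addr0) mul1r. Qed.

Lemma norm_PQ a (b : F * F) :
  mul (0, b) (a, (0, 0)) = (W b.2 * s (0, b) * a, b).
Proof.
by rewrite mulE /= w0 subrr !(mulr0, addr0) add0r mulrA; case: b.
Qed.

Lemma norm_QP a (b : F * F) :
  mul (a, (0, 0)) (0, b) = (a + c (a, (0, 0)) * (W b.2 - 1), b).
Proof.
by rewrite mulE /= w0 !mulr0 !mul0r mulr0 !add0r addr0 mul1r; case: b.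
Qed.

(* A cocycle vanishing on the normal Sylow subgroup descends to the quotient,
   of order [p ^ 2] prime to [q], where averaging makes it a coboundary. *)
Lemma cocycle_coboundary (f r : carrier p q -> R) m0 :
  (forall x y, f (mul x y) = f x + r x * f y) ->
  (forall x y, r (mul x y) = r x * r y) ->
  (forall a, f (a, (0, 0)) = m0 * (1 - r (a, (0, 0)))) ->
  exists m, forall x, f x = m * (1 - r x).
Proof.
move=> fM rM fQ; pose g x := f x - m0 * (1 - r x).
have gM x y : g (mul x y) = g x + r x * g y by rewrite /g fM rM; ring.
have gQ a : g (a, (0, 0)) = 0 by rewrite /g fQ subrr.
have gP a b : g (a, b) = g (0, b).
  have := norm_PQ ((W b.2 * s (0, b))^-1 * a) b.
  rewrite mulVKr ?unitrMl ?sU ?upow_unit // => <-.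
  by rewrite gM gQ mulr0 addr0.
pose M := \sum_(b : F * F) g (0, b).
(* The cocycle identity is summed over [b]; left multiplication by [x] permutes the fibers over the
   [b]-part. *)
have gE x : M = p%:R ^+ 2 * g x + r x * M.
  pose h (b : F * F) := (x.2.1 + b.1 + d * (x.2.2 * b.2), x.2.2 + b.2).
  have hI : injective h.
    move=> [b1 b2] [b1' b2'] e; have := congr1 snd e; have := congr1 fst e.
    by rewrite /h /= => + /addrI e2; rewrite e2 => /addIr /addrI ->.
  rewrite {1}/M (reindex_inj hI) /=.
  rewrite (eq_bigr (fun b => g x + r x * g (0, b))) => [|b _]; last first.
    by rewrite -gM mulE [RHS]gP.
  rewrite big_split /= sumr_const -mulr_sumr -/M card_prod !card_ord Fp_cast //.
  by rewrite -[g x *+ _]mulr_natl natrM expr2.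
exists (m0 + p%:R ^- 2 * M) => x.
have pU : p%:R ^+ 2 \is a @GRing.unit R by rewrite unitrX ?natr_pZ.
have := gE x => /eqP; rewrite -subr_eq => /eqP /(congr1 (fun y => p%:R ^- 2 * y)).
rewrite mulKr // /g => e; have -> : f x = m0 * (1 - r x) + (f x - m0 * (1 - r x)).
  by ring.
by rewrite -e; ring.
Qed.

(** The first coordinate of [mul x y] is [D x + W y.2.2 * (W x.2.2 * c x) + r x * y.1]: [D] is the
    untwisted part of [x.1]. A shift removes the [c] part or the [D] part. *)
Let r x := W x.2.2 * s x.
Let D x := x.1 - W x.2.2 * c x.

Lemma norm_rM x y : r (mul x y) = r x * r y.
Proof. by rewrite /r sM mulE /= upowD //; ring. Qed.

Lemma norm_DM x y : D (mul x y) = D x + r x * D y.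
Proof. by rewrite /D /r cM mulE /= upowD //; ring. Qed.

(** On Z/q^2 one has [c = K a] and [s = 1 + pi t a]. The relation on [K (K - 1)] leaves [K] equal to
    0 or 1 modulo [q] and makes [K a], respectively [(1 - K) a], a multiple of [1 - s]. *)
Lemma norm_c : exists m, (forall x, c x = m * (1 - s x)) \/
                         (forall x, D x = m * (1 - r x)).
Proof.
pose sQ a := s (a, (0, 0)).
have sQU a : sQ a \is a GRing.unit by exact: sU.
have sQM a a' : sQ (a + sQ a * a') = sQ a * sQ a' by rewrite /sQ -norm_Q sM.
have [t st] := cyc_s q_pr sQU sQM.
pose K := c (1, (0, 0)).
have cQ a : c (a, (0, 0)) = K * a.
  by apply: (cyc_cocycle q_pr sQU sQM (f := fun a => c (a, (0, 0)))) => // a1 a2;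
     rewrite -norm_Q cM.
have u1 : W 1 - 1 \is a GRing.unit.
  by apply: (upow_sub1_unit p_pr q_pr pq ordu); rewrite oner_neq0.
(* [a] is chosen so that [1 o y = y o a]; applying [c] to both sides gives the relation. *)
have [z zE] : exists z, K * (K - 1) = pi * t * z.
  pose y : carrier p q := (0, (0, 1)).
  pose a := (W 1 * s y)^-1 * (1 + K * (W 1 - 1)).
  have e1 : mul (1, (0, 0)) y = mul y (a, (0, 0)).
    by rewrite norm_QP norm_PQ /= /a mulVKr ?unitrMl ?sU ?upow_unit // cQ mulr1.
  have := congr1 c e1; rewrite !cM !cQ -/(sQ 1) st !mulr1 => e2.
  exists (W 1 * c y / (W 1 - 1)); apply: (mulIr u1); rewrite -[RHS]mulrA divrK //.
  have e3 : W 1 * s y * a = 1 + K * (W 1 - 1).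
    by rewrite /a mulVKr ?unitrMl ?sU ?upow_unit.
  transitivity (K * (W 1 * s y * a) - W 1 * K); first by rewrite e3; ring.
  transitivity (W 1 * (c y + s y * (K * a) - c y - K)); first by ring.
  by rewrite -e2; ring.
have : red K * (red K - 1) == 0.
  have -> : red K * (red K - 1) = red (K * (K - 1)) by rewrite redM // redB // red1.
  by rewrite zE -mulrA redM // red_pi // mul0r.
rewrite mulf_eq0 subr_eq0 => /orP[/eqP K0|/eqP K1].
  have U : K - 1 \is a GRing.unit.
    by rewrite red_unit // redB // K0 red1 // sub0r oppr_eq0 oner_neq0.
  have cQ' a : c (a, (0, 0)) = - z / (K - 1) * (1 - s (a, (0, 0))).
    rewrite cQ -/(sQ a) st; apply: (mulIr U).
    transitivity (K * (K - 1) * a); first by ring.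
    rewrite zE; transitivity (- z / (K - 1) * (K - 1) * (1 - (1 + pi * t * a))); last by ring.
    by rewrite divrK //; ring.
  by have [m mE] := cocycle_coboundary cM sM cQ'; exists m; left.
have U : K \is a GRing.unit by rewrite red_unit // K1 oner_neq0.
have DQ a : D (a, (0, 0)) = z / K * (1 - r (a, (0, 0))).
  rewrite /D /r /= w0 !mul1r cQ -/(sQ a) st; apply: (mulIr U).
  transitivity (- (K * (K - 1) * a)); first by ring.
  rewrite zE; transitivity (z / K * K * (1 - (1 + pi * t * a))); last by ring.
  by rewrite divrK //; ring.
by have [m mE] := cocycle_coboundary norm_DM norm_rM DQ; exists m; right.
Qed.

(** The law is carried along a shift by [- m] if [c] is a coboundary ([eps = false]), by [m] if [D]
    is ([eps = true]); [r'] is [r] read through the inverse shift. *)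
Lemma norm_iso : exists eps r',
  skew_brace_isomorphic (add_law p u) mul (add_law p u)
    (fun x y : carrier p q => (W ((eps : bool)%:R * y.2.2) * x.1 + r' x * y.1,
       (x.2.1 + y.2.1 + d * (x.2.2 * y.2.2), x.2.2 + y.2.2)))
  /\ (forall x, r' x \is a GRing.unit).
Proof.
have shift m : exists f g : carrier p q -> carrier p q,
    [/\ forall x, f x = (x.1 + m * (W x.2.2 - 1), x.2), cancel f g, cancel g f &
        {morph f : x y / add_law p u x y}].
  exists (fun x => (x.1 + m * (W x.2.2 - 1), x.2)).
  exists (fun x => (x.1 - m * (W x.2.2 - 1), x.2)); split=> //.
  - by move=> [a b] /=; rewrite addrK.
  - by move=> [a b] /=; rewrite subrK.
  - move=> x y; rewrite !add_lawE /= upowD //; congr (_, _); ring.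
have rU x : r x \is a GRing.unit by rewrite unitrMl ?upow_unit ?sU.
have [m [cE|DE]] := norm_c.
- have [f [g [fE fK gK fD]]] := shift (- m).
  exists false, (r \o g); split; last by move=> x; exact: rU.
  exists f; split=> //; first by exists g.
  move=> x y; rewrite /= fK !fE mulE /= upowD // cE mul0r w0 /r; congr (_, _); ring.
have [f [g [fE fK gK fD]]] := shift m.
exists true, (r \o g); split; last by move=> x; exact: rU.
exists f; split=> //; first by exists g.
move=> x y; rewrite /= fK !fE mulE /= upowD // mul1r; congr (_, _).
have := DE x; rewrite /D /r => e.
have -> : W x.2.2 * (s x * y.1 + c x * (W y.2.2 - 1)) =
  W x.2.2 * s x * y.1 + (x.1 - (x.1 - W x.2.2 * c x)) * (W y.2.2 - 1) by ring.
by rewrite e; ring.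
Qed.

End Normalization.

(** * Determination of the character, and the classification over [add_law] *)

Section Classification.

Variables (p q : nat) (u : {unit 'Z_(q ^ 2)}).
Hypotheses (p_pr : prime p) (q_pr : prime q) (pq : (p %| q - 1)%N).
Hypotheses (p_odd : odd p) (q_odd : odd q) (ordu : #[u]%g = p).
Notation R := 'Z_(q ^ 2).
Notation F := 'F_p.
Notation W := (@upow p q u).
Notation pi := (q%:R : R).

Let w0 : W 0 = 1. Proof. exact: upow0. Qed.

Lemma hom_upow (h : F -> R) : h 0 = 1 -> (forall x y, h (x + y) = h x * h y) ->
  exists k, forall x, h x = W (k * x).
Proof.
move=> h0 hD; have hn n : h n%:R = h 1 ^+ n.
  by elim: n => [|n IH]; rewrite ?expr0 // -natr1 hD IH exprSr.
have [k hk] := root_upow p_pr q_pr pq ordu (etrans (esym (hn p)) (etrans (congr1 h (pchar_Fp_0 p_pr)) h0)).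
exists k => x; rewrite [in LHS](natr_valF x) hn hk [in RHS](natr_valF x).
elim: (x : nat) => [|n IH]; first by rewrite expr0 mulr0 w0.
by rewrite exprS IH -natr1 mulrDr mulr1 upowD // mulrC.
Qed.

Definition nlaw (eps : bool) (r : carrier p q -> R) (d : F) (x y : carrier p q) :
    carrier p q :=
  (W (eps%:R * y.2.2) * x.1 + r x * y.1,
   (x.2.1 + y.2.1 + d * (x.2.2 * y.2.2), x.2.2 + y.2.2)).

(** Associativity makes [r] a character. It is [1 + pi t a] on Z/q^2 by [cyc_s], and a power of [u]
    on the [b]-part; factoring [(a, b)] as an element over [b] times one of Z/q^2 glues the two. *)
Lemma nlaw_glaw eps r d : (forall x, r x \is a GRing.unit) ->
    associative (nlaw eps r d) ->
  exists k l t, gvalid eps k l t /\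
    forall x y, nlaw eps r d x y = glaw u eps k l d t x y.
Proof.
move=> rU nA.
have rM x y : r (nlaw eps r d x y) = r x * r y.
  have := congr1 fst (nA x y (1, (0, 0))).
  set m := nlaw eps r d x y; rewrite /nlaw /= addr0 mulr0 w0 !mul1r !mulr1 => e.
  apply: (addrI m.1); rewrite -e /m /nlaw /=; ring.
have nQ a a' : nlaw eps r d (a, (0, 0)) (a', (0, 0)) = (a + r (a, (0, 0)) * a', (0, 0)).
  by rewrite /nlaw /= mulr0 w0 mul1r !mulr0 !addr0.
pose sQ a := r (a, (0, 0)).
have sQU a : sQ a \is a GRing.unit by exact: rU.
have sQM a a' : sQ (a + sQ a * a') = sQ a * sQ a' by rewrite /sQ -nQ rM.
have [t st] := cyc_s q_pr sQU sQM.
have rE a b : r (a, b) = r (0, b) + pi * t * a.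
  have : nlaw eps r d (0, b) ((r (0, b))^-1 * a, (0, 0)) = (a, b).
    by rewrite /nlaw /= mulVKr // !mulr0 !addr0 add0r; case: b.
  by move=> <-; rewrite rM -/(sQ _) st mulrDr mulr1 mulrCA mulVKr.
have r00 : r (0, (0, 0)) = 1 by rewrite -/(sQ 0) st mulr0 addr0.
have rP (b b' : F * F) :
    r (0, (b.1 + b'.1 + d * (b.2 * b'.2), b.2 + b'.2)) = r (0, b) * r (0, b').
  by rewrite -rM /nlaw /= !mulr0 addr0.
(* In these coordinates the law on the [b]-part is plain addition, so [hom_upow] applies to each
   variable. *)
pose e (x1 x2 : F) := r (0, (x1 + d * (x2 * (x2 - 1) / 2%:R), x2)).
have eM x1 x2 y1 y2 : e (x1 + y1) (x2 + y2) = e x1 x2 * e y1 y2.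
  rewrite /e -rP /=; congr (r (_, (_, _))); field; exact: two_neq0.
have e00 : e 0 0 = 1 by rewrite /e !mul0r mulr0 addr0.
have [k ek] : exists k, forall x, e x 0 = W (k * x).
  by apply: hom_upow => // x y; rewrite -eM addr0.
have [l el] : exists l, forall x, e 0 x = W (l * x).
  by apply: hom_upow => // x y; rewrite -eM addr0.
have rG b : r (0, b) = W (gexp k l d b).
  rewrite /gexp upowD // -ek -el -eM /e addr0 add0r subrK; by case: b.
exists k, l, t; split; last first.
  by move=> [a b] y; rewrite /nlaw /glaw /grho rE rG.
have [|t0] := eqVneq (pi * t) 0; [by left | right].
have tU : t \is a GRing.unit.
  rewrite red_unit //; apply: contraNneq t0 => /(red_eq0 q_pr)[y ->].
  by rewrite mulrA pi_sqr // mul0r.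
(* Applying [r] to [(1, 0) o (0, b) = (u^(eps b2), b)] gives [pi t u^(gexp b) = pi t u^(eps b2)]; as
   [t] is a unit, the powers agree modulo [q]. *)
have G (b : F * F) : gexp k l d b = eps%:R * b.2.
  apply: (red_upow_inj p_pr q_pr pq ordu); apply/eqP; rewrite -subr_eq0 -redB //.
  apply/eqP/(pi_mul_eq0 q_pr); apply: (mulIr tU); rewrite mul0r.
  have : nlaw eps r d (1, (0, 0)) (0, b) = (W (eps%:R * b.2), b).
    by rewrite /nlaw /= mulr1 mulr0 mul0r mulr0 !addr0 !add0r; case: b.
  move/(congr1 r); rewrite rM (rE 1) (rE (W _)) r00 rG => e1.
  transitivity ((1 + pi * t * 1) * W (gexp k l d b) -
    (W (gexp k l d b) + pi * t * W (eps%:R * b.2))); first by ring.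
  by rewrite e1 subrr.
have := G (1, 0); have := G (0, 1); rewrite /gexp /=.
by rewrite !(mul0r, mulr0, subrr, subr0, oppr0, add0r, addr0, mulr1) => -> ->.
Qed.

Lemma skew_brace_classification (mul : carrier p q -> carrier p q -> carrier p q)
    zero opp one inv :
  group_axioms (add_law p u) zero opp -> group_axioms mul one inv ->
  (forall x y z, mul x (add_law p u y z) =
     add_law p u (add_law p u (mul x y) (opp x)) (mul x z)) ->
  exists2 i : nat, (i < size (mul_laws p u))%N &
    skew_brace_isomorphic (add_law p u) mul (add_law p u) (mul_law p u i).
Proof.
move=> addG mulG mulD.
have [s [c [al [be [sU al0 mulE]]]]] :=
  lambda_coordinates p_pr q_pr pq ordu mulG addG mulD.
have sM := coord_sM p_pr ordu mulG mulE.
have cM := coord_cM p_pr q_pr pq ordu mulG mulE.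
have [d beE] := coord_be p_pr q_pr pq ordu mulG sU al0 mulE.
have alE := coord_al p_pr q_pr pq ordu mulG al0 mulE.
have mulE' x y : mul x y =
  (x.1 + W x.2.2 * (s x * y.1 + c x * (W y.2.2 - 1)),
   (x.2.1 + y.2.1 + d * (x.2.2 * y.2.2), x.2.2 + y.2.2)).
  by rewrite mulE alE beE mul1r addrA mulrA.
have [eps [r [iso1 rU]]] := norm_iso p_pr q_pr pq q_odd ordu sU sM cM mulE'.
have nA : associative (nlaw eps r d).
  have [mulA _ _ _ _] := mulG; have [f [[g fK gK] _ fM]] := iso1.
  move=> x y z; rewrite -(gK x) -(gK y) -(gK z).
  have E a b : nlaw eps r d (f a) (f b) = f (mul a b) by rewrite fM.
  by rewrite !E mulA.
have [k [l [t [v nE]]]] := nlaw_glaw rU nA.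
have [P Pp iso2] := glaw_canonical u p_pr q_pr p_odd d v.
exists (index P (params p)).
  by rewrite mul_laws_params // size_map index_mem.
rewrite mul_lawE ?mul_laws_params ?size_map ?index_mem // nth_index //.
apply: skew_brace_isomorphic_comp iso2; have [f [f_bij fD fM]] := iso1.
by exists f; split=> // x y; rewrite fM -nE.
Qed.

End Classification.

(** * Transport from an arbitrary skew brace to the fixed carrier *)

Lemma group_axioms_transport (S T : Type) (op : S -> S -> S) (e : S)
    (inv : S -> S) (f : S -> T) (g : T -> S) : cancel f g -> cancel g f ->
  group_axioms op e inv ->
  group_axioms (fun x y => f (op (g x) (g y))) (f e) (fun x => f (inv (g x))).
Proof.
move=> fK gK [opA op1x opx1 opVx opxV].
by split=> [x y z|x|x|x|x]; rewrite !fK ?opA ?op1x ?opx1 ?opVx ?opxV.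
Qed.

Theorem proposition13 (p q : nat) (u : {unit 'Z_(q ^ 2)}) :
  prime p -> prime q -> odd p -> odd q -> (p %| q - 1)%N -> #[u]%g = p ->
  [/\ size (mul_laws p u) = (6 * p + 4)%N,
      forall i : nat, (i < size (mul_laws p u))%N ->
        is_skew_brace (add_law p u) (mul_law p u i),
      forall i j : nat,
        (i < size (mul_laws p u))%N -> (j < size (mul_laws p u))%N ->
        skew_brace_isomorphic (add_law p u) (mul_law p u i)
                              (add_law p u) (mul_law p u j) -> i = j
    & forall (B : Type) (add mul : B -> B -> B),
        is_skew_brace add mul -> group_isomorphic add (add_law p u) ->
        exists2 i : nat, (i < size (mul_laws p u))%N &
          skew_brace_isomorphic add mul (add_law p u) (mul_law p u i)].

Proof.
move=> p_pr q_pr p_odd q_odd pq ordu; split.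
- by rewrite mul_laws_params // size_map size_params ?prime_gt0.
- move=> i ip; rewrite mul_lawE //; set P := nth _ _ _.
  have : P \in params p.
    by rewrite mem_nth //; move: ip; rewrite mul_laws_params // size_map.
  rewrite mem_params ?prime_gt1 //; case: P => [[[[eps k] l] d] t] /and4P[_ _ _ tP].
  apply: glaw_skew_brace => //; case: t tP => [/andP[/eqP-> /eqP->]|_].
    by right; split=> //; case: eps.
  by left; rewrite mulr0.
- exact: mul_law_distinct.
move=> B add mul [zero [opp [one [inv [addG mulG mulD]]]]] [f [g fK gK] fD].
(* The structure of [B] is carried along [f], which turns its addition into [add_law]. *)
have addG' : group_axioms (add_law p u) (f zero) (fun x => f (opp (g x))).
  apply: group_axioms_ext (group_axioms_transport fK gK addG) => x y.
  by rewrite fD !gK.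
have mulD' x y z : f (mul (g x) (g (add_law p u y z))) =
    add_law p u (add_law p u (f (mul (g x) (g y))) (f (opp (g x)))) (f (mul (g x) (g z))).
  have E a b : add_law p u (f a) (f b) = f (add a b) by rewrite fD.
  by rewrite -{1}(gK y) -{1}(gK z) !E !fK mulD.
have [i ip iso] := skew_brace_classification p_pr q_pr pq p_odd q_odd ordu addG'
  (group_axioms_transport fK gK mulG) mulD'.
exists i => //; apply: skew_brace_isomorphic_comp iso.
by exists f; split=> // [|x y]; [exists g | rewrite !fK].
Qed.
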